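(* Let $d\ge2$. For $d$-languages represented by coordinate structures: $$\mathrm{REC}^d\subsetneq\mathrm{ESO}(\mathrm{var}\ d)=\mathrm{ESO}(\forall^d,\mathrm{arity}\ d)\subsetneq\mathrm{ESO}(\forall^{d+1},\mathrm{arity}\ d)\subseteq\mathrm{ESO}(\forall^{d+1},\mathrm{arity}\ d+1)=\mathrm{ESO}(\mathrm{var}\ d+1)=\mathrm{NLIN}_{CA}^d.$$
   Context: For $n\ge1$ let $[n]=\{1,\dots,n\}$. A $d$-picture over a finite alphabet $\Sigma$ is a map $p:[n]^d\to\Sigma$; a $d$-language is a set of such pictures. For a logic $\mathcal C$, $\mathcal C$ also denotes the class of $d$-languages $L$ for which some $\Phi\in\mathcal C$ satisfies: $p\in L$ iff $\mathrm{coord}^d(p)\models\Phi$ for every $d$-picture $p$ over $\Sigma$. Coordinate structure: $\mathrm{coord}^d(p)$ has domain $[n]$, $d$-ary relations $Q_s=\{a\in[n]^d:p(a)=s\}$, the order $<$, $\min=\{1\}$, $\max=\{n\}$, and cyclic successor $\mathrm{succ}$ ($\mathrm{succ}(i)=i+1$ for $i<n$, $\mathrm{succ}(n)=1$). Logics: $\mathrm{ESO}(\forall^k,\mathrm{arity}\ \ell)$: sentences $\exists R_1\dots\exists R_m\,\forall x_1\dots\forall x_k\,\theta$, $R_j$ of arity at most $\ell$, $\theta$ quantifier-free. $\mathrm{ESO}(\mathrm{var}\ k)$: sentences $\exists R_1\dots\exists R_m\,\varphi$, $R_j$ of any arity, $\varphi$ first-order with at most $k$ distinct first-order variables. Recognizability: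 for finite $\Gamma$, $\sharp\notin\Gamma$, $\Gamma^\sharp=\Gamma\cup\{\sharp\}$; the bordered picture $p^\sharp:[0,n+1]^d\to\Gamma^\sharp$ of $p:[n]^d\to\Gamma$ equals $p$ on $[n]^d$ and $\sharp$ elsewhere. Points are $j$-adjacent if they agree except in coordinate $j$, where they differ by exactly $1$. $p$ is $j$-tiled by $\Delta_j\subseteq(\Gamma^\sharp)^2$ if $(p^\sharp(a),p^\sharp(b))\in\Delta_j$ for all $j$-adjacent $a,b\in[0,n+1]^d$; $L(\Delta_1,\dots,\Delta_d)$ is the set of $d$-pictures over $\Gamma$ $j$-tiled by $\Delta_j$ for all $j$. $\mathrm{REC}^d$: $d$-languages $L$ over $\Sigma$ with $L=\{\pi\circ p:p\in L(\Delta_1,\dots,\Delta_d)\}$ for some finite $\Gamma$, surjection $\pi:\Gamma\to\Sigma$, $\Delta_j\subseteq(\Gamma^\sharp)^2$. Cellular automata: $\mathcal A=(\Sigma,\Gamma,\delta,F)$, finite $\Gamma\supseteq\Sigma\cup F$, $\delta:\Gamma\times(\Gamma\cup\{\sharp\})^d\to\mathcal P(\Gamma)$. For $q,q':[n]^d\to\Gamma$, $q'$ is a successor of $q$ if $q'(a)\in\delta(q(a),q^\sharp(a^{(1)}),\dots,q^\sharp(a^{(d)}))$ for all $a\in[n]^d$, where $a^{(i)}$ is $a$ with $i$-th coordinate $a_i+1$ and $q^\sharp$ equals $q$ on $[n]^d$ and $\sharp$ outside. $p:[n]^d\to\Sigma$ is accepted in time $T$ if there is a sequence $p=p_1,\dots,p_{T(n)}$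 of successive successors with $p_{T(n)}(1,\dots,1)\in F$. $L\in\mathrm{NLIN}_{CA}^d$ iff for some automaton and integers $c,c'$ with $T(n)=cn+c'>n$ for all $n$, $L$ is exactly the set of $d$-pictures over $\Sigma$ accepted by $\mathcal A$ in time $T$. *)

(* Defs.v *)
From mathcomp Require Import all_boot all_order all_algebra.

Set Implicit Arguments.
Unset Strict Implicit.
Unset Printing Implicit Defensive.

(* The index n encodes the side n.+1, so that sides are positive;
   the ordinal i : 'I_n.+1 stands for the coordinate i.+1. *)
Definition picture (d : nat) (S : finType) (n : nat) :=
  {ffun d.-tuple 'I_n.+1 -> S}.

Definition language (d : nat) (S : finType) :=
  forall n : nat, picture d S n -> Prop.

Definition lang_class (d : nat) := forall S : finType, language d S -> Prop.

Definition class_sub d (C C' : lang_class d) : Prop :=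
  forall (S : finType) (L : language d S), C S L -> C' S L.

Definition class_eq d (C C' : lang_class d) : Prop :=
  class_sub C C' /\ class_sub C' C.

Definition class_proper d (C C' : lang_class d) : Prop :=
  class_sub C C' /\
  exists (S : finType) (L : language d S), C' S L /\ ~ C S L.

Definition relabel d n (G S : finType) (f : G -> S) (p : picture d G n) :
  picture d S n := [ffun a => f (p a)].

(* The logical vocabulary is Q_s (of arity d), <, min, max (unary relations),
   the unary function succ, equality, and relation variables R_j. *)
Record structure (d : nat) (S : finType) := Structure {
  dom :> finType;
  str_Q : S -> {set d.-tuple dom};
  str_lt : rel dom;
  str_min : {set dom};
  str_max : {set dom};
  str_succ : dom -> dom }.

Definition coord d (S : finType) n (p : picture d S n) : structure d S :=
  @Structure d S 'I_n.+1
    (fun s => [set a | p a == s])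
    (fun i j => (i < j)%N)
    [set ord0] [set ord_max]
    (@ordS n.+1).

Inductive term (k : nat) :=
  | TVar of 'I_k
  | TSucc of term k.

(* At most k distinct first-order variables: those of a formula range over 'I_k. *)
Inductive formula (d : nat) (S : finType) (k m : nat) (ar : 'I_m -> nat) :=
  | FEq of term k & term k
  | FLt of term k & term k
  | FMin of term k
  | FMax of term k
  | FQ of S & d.-tuple (term k)
  | FR (j : 'I_m) of (ar j).-tuple (term k)
  | FNot of formula d S k ar
  | FAnd of formula d S k ar & formula d S k ar
  | FOr of formula d S k ar & formula d S k ar
  | FAll of 'I_k & formula d S k ar
  | FEx of 'I_k & formula d S k ar.

Arguments FEq {d S k m ar}.
Arguments FLt {d S k m ar}.
Arguments FMin {d S k m ar}.
Arguments FMax {d S k m ar}.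
Arguments FQ {d S k m ar}.
Arguments FR {d S k m ar}.

Fixpoint tvar k (t : term k) : 'I_k :=
  match t with TVar x => x | TSucc t' => tvar t' end.

Fixpoint teval d S (M : structure d S) k (v : 'I_k -> M) (t : term k) : M :=
  match t with TVar x => v x | TSucc t' => str_succ (teval v t') end.

Definition upd d S (M : structure d S) k (v : 'I_k -> M) (x : 'I_k) (a : M) :
  'I_k -> M := fun y => if y == x then a else v y.

Fixpoint sat d S (M : structure d S) k m (ar : 'I_m -> nat)
    (R : forall j, {set (ar j).-tuple M}) (v : 'I_k -> M)
    (f : formula d S k ar) : bool :=
  match f with
  | FEq t u => teval v t == teval v u
  | FLt t u => str_lt (teval v t) (teval v u)
  | FMin t => teval v t \in str_min M
  | FMax t => teval v t \in str_max M
  | FQ s ts => map_tuple (teval v) ts \in str_Q M s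
  | FR j ts => map_tuple (teval v) ts \in R j
  | FNot g => ~~ sat R v g
  | FAnd g h => sat R v g && sat R v h
  | FOr g h => sat R v g || sat R v h
  | FAll x g => [forall a : M, sat R (upd v x a) g]
  | FEx x g => [exists a : M, sat R (upd v x a) g]
  end.

Fixpoint qfree d S k m (ar : 'I_m -> nat) (f : formula d S k ar) : bool :=
  match f with
  | FNot g => qfree g
  | FAnd g h | FOr g h => qfree g && qfree h
  | FAll _ _ | FEx _ _ => false
  | _ => true
  end.

Fixpoint fv d S k m (ar : 'I_m -> nat) (f : formula d S k ar) : {set 'I_k} :=
  match f with
  | FEq t u | FLt t u => [set tvar t; tvar u]
  | FMin t | FMax t => [set tvar t]
  | FQ _ ts => [set x in map (@tvar k) ts]
  | FR _ ts => [set x in map (@tvar k) ts]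
  | FNot g => fv g
  | FAnd g h | FOr g h => fv g :|: fv h
  | FAll x g | FEx x g => fv g :\ x
  end.

Definition forall_all d S k m (ar : 'I_m -> nat) (f : formula d S k ar) :
  formula d S k ar := foldr (@FAll d S k m ar) f (enum 'I_k).

Record eso (d : nat) (S : finType) (k : nat) := ESO {
  eso_num : nat;
  eso_ar : 'I_eso_num -> nat;
  eso_body : formula d S k eso_ar }.

(* Only used for closed bodies, for which the valuation is irrelevant. *)
Definition models d S k (M : structure d S) (Phi : eso d S k) : Prop :=
  exists R : forall j, {set (eso_ar (e := Phi) j).-tuple M},
    forall v : 'I_k -> M, sat R v (eso_body Phi).

Definition defines d S k (Phi : eso d S k) (L : language d S) : Prop :=
  forall n (p : picture d S n), L n p <-> models (coord p) Phi.

Definition ESO_forall (d k l : nat) : lang_class d := fun S L =>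
  exists Phi : eso d S k,
    [/\ forall j, (eso_ar (e := Phi) j <= l)%N,
        exists2 theta, qfree theta & eso_body Phi = forall_all theta
      & defines Phi L].

Definition ESO_var (d k : nat) : lang_class d := fun S L =>
  exists Phi : eso d S k, fv (eso_body Phi) = set0 /\ defines Phi L.

(* The bordered picture, with None as the border symbol.  Points are given by
   their actual coordinates, so that the picture occupies [1, n.+1]^d; the
   value is None at every other point of nat^d. *)
Definition bordered d (G : finType) n (p : picture d G n) (a : d.-tuple nat) :
  option G :=
  if [forall i, 0 < tnth a i <= n.+1]%N
  then Some (p [tuple inord (tnth a i).-1 | i < d])
  else None.

Definition adjacent d (j : 'I_d) (a b : d.-tuple nat) : Prop :=
  (forall i, i != j -> tnth a i = tnth b i) /\
  (tnth b j = (tnth a j).+1 \/ tnth a j = (tnth b j).+1).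

Definition in_frame d n (a : d.-tuple nat) : Prop :=
  forall i, (tnth a i <= n.+2)%N.

Definition tiled d (G : finType) n (j : 'I_d)
    (D : {set option G * option G}) (p : picture d G n) : Prop :=
  forall a b : d.-tuple nat, in_frame n a -> in_frame n b ->
    adjacent j a b -> (bordered p a, bordered p b) \in D.

Definition REC (d : nat) : lang_class d := fun S L =>
  exists (G : finType) (pi : G -> S) (D : 'I_d -> {set option G * option G}),
    (forall s, exists g, pi g = s) /\
    forall n (p : picture d S n),
      L n p <-> exists2 q : picture d G n,
                  forall j, tiled j (D j) q & p = relabel pi q.

(* The inclusion of the input alphabet in the set of states is the
   injection ca_in. *)
Record automaton (d : nat) (S : finType) := Automaton {
  ca_state : finType;
  ca_in : S -> ca_state;
  ca_in_inj : injective ca_in;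
  ca_delta : ca_state -> d.-tuple (option ca_state) -> {set ca_state};
  ca_final : {set ca_state} }.

(* The actual coordinates of the neighbour of the cell a in direction i. *)
Definition neighbour d n (a : d.-tuple 'I_n.+1) (i : 'I_d) : d.-tuple nat :=
  [tuple (tnth a j).+1 + (j == i) | j < d]%N.

Definition ca_step d S (A : automaton d S) n
    (q q' : picture d (ca_state A) n) : Prop :=
  forall a, q' a \in
    ca_delta (q a) [tuple bordered q (neighbour a i) | i < d].

Definition ca_accepts d S (A : automaton d S) (T n : nat)
    (p : picture d S n) : Prop :=
  exists run : nat -> picture d (ca_state A) n,
    [/\ run 1%N = relabel (@ca_in _ _ A) p,
        forall t, (1 <= t < T)%N -> ca_step (run t) (run t.+1)
      & run T [tuple ord0 | i < d] \in ca_final A].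

Definition lin_time (c c' : int) (n : nat) : int := (c * n%:Z + c')%R.

(* absz is exact here: lin_time c c' takes positive values on sides. *)
Definition NLIN_CA (d : nat) : lang_class d := fun S L =>
  exists (A : automaton d S) (c c' : int),
    (forall n, (0 < n)%N -> (n%:Z < lin_time c c' n)%R) /\
    forall n (p : picture d S n),
      L n p <-> ca_accepts A `|lin_time c c' n.+1|%N p.

(* Main.v *)
From mathcomp Require Import all_boot all_order all_algebra all_fingroup zify.
From Stdlib Require Import FunctionalExtensionality.
Require Import Defs.

(** All the logical classes are first put in a common form: a picture belongs to
    the language iff some finite colouring [c] of [[N]^l] satisfies, for every
    valuation [v] of the [k] variables, a condition on the finite table of all
    atoms over [v] with boundedly many successors.  To bring a formula with [k]
    variables into this form with [l = k], its subformulas are guessed as [k]-ary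
    relations; a quantifier is checked by propagating partial disjunctions along
    its variable, and a guessed atom of large arity only has to agree with the
    guessed atoms whose variables are shifts of its own, since the successor is
    a bijection.

    A colouring of [[N]^(d+1)] becomes a space-time diagram of a one-way
    nondeterministic automaton once its condition only relates neighbouring
    points.  For this the cube is folded: the new colour at [x] lists the old
    colours of all points whose coordinates occur in [x].  Only nondecreasing
    points [x] matter for the injective reorderings, and the lists agree on
    points with repeated coordinates because values can be carried from one
    coordinate to another through the spare one.  Conversely, a run of linear
    length is cut into boundedly many blocks of [N] steps.

    Both separations count the colours on a frontier of [O(N^(d-1))] points,
    against [2^(h^d)] pictures with [h] proportional to [N]: symmetric pictures
    cut along a hyperplane for recognizability, transitive ones cut at the cube
    of small coordinates for [d] variables. *)

Set Implicit Arguments.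
Unset Strict Implicit.
Unset Printing Implicit Defensive.

(** A cell sees only its forward neighbours, whereas a formula may compare a guessed relation at
    [(x, y)] and at [(y, x)], about [N] apart; this obstacle is the reason for folding. The price is
    that renamings of coordinates must be kept consistent as a point moves. Colourings turn the
    comparison of logics into a cycle: [k] variables, colourings of [[N]^k], [k] universal variables
    with arity [k], and back. This gives both equalities between logics at once. The automata built
    from colourings run for exactly [N + 2] steps, so linear time gives no more than that. Both
    separating languages are universal conditions with no guessed relation. Symmetry ties points on
    opposite sides of a hyperplane, so a tiling would have to carry a full cube of bits across it.
    Transitivity relates three points through [d + 1] variables; with only [d], a point built from
    [d] terms that avoids one variable must repeat another, so two of its coordinates differ by a
    bounded shift. This is why so little information crosses the second cut. *)

Definition pt (k n : nat) := {ffun 'I_k -> 'I_n.+1}.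

Definition pt_tuple k n (x : pt k n) : k.-tuple 'I_n.+1 := [tuple x i | i < k].

Definition tuple_pt k n (a : k.-tuple 'I_n.+1) : pt k n := [ffun i => tnth a i].

Lemma pt_tupleK k n : cancel (@pt_tuple k n) (@tuple_pt k n).
Proof. by move=> x; apply/ffunP => i; rewrite ffunE tnth_mktuple. Qed.

Lemma tuple_ptK k n : cancel (@tuple_pt k n) (@pt_tuple k n).
Proof. by move=> a; apply: eq_from_tnth => i; rewrite tnth_mktuple ffunE. Qed.

Definition sterm (k M : nat) : finType := ('I_k * 'I_M.+1)%type.

Definition seval k M n (v : pt k n) (w : sterm k M) : 'I_n.+1 :=
  iter w.2 (@ordS n.+1) (v w.1).

Definition act k M r n (w : {ffun 'I_r -> sterm k M}) (v : pt k n) : pt r n :=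
  [ffun i => seval v (w i)].

(** * Local views *)

Section View.

Variables (d k l M : nat) (S G : finType).

Definition view_type : finType :=
  ({ffun {ffun 'I_l -> sterm k M} -> G} * {ffun {ffun 'I_d -> sterm k M} -> S} *
   {ffun sterm k M -> bool * bool} *
   {ffun sterm k M * sterm k M -> bool * bool})%type.

Definition view n (p : picture d S n) (c : pt l n -> G) (v : pt k n) :
    view_type :=
  ([ffun w => c (act w v)], [ffun w => p (pt_tuple (act w v))],
   [ffun w => (seval v w == ord0, seval v w == ord_max)],
   [ffun w => ((seval v w.1 < seval v w.2)%N, seval v w.1 == seval v w.2)]).

(** [f] is chosen before the side, the picture and the colouring; this uniformity lets one finite
    table become a single formula or a single transition function. *)
Definition local_fun (H : Type)
    (X : forall n, picture d S n -> (pt l n -> G) -> pt k n -> H) : Prop :=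
  exists f : view_type -> H, forall n p c v, X n p c v = f (view p c v).

Lemma local_const (H : Type) (h : H) : local_fun (fun n p c v => h).
Proof. by exists (fun=> h). Qed.

Lemma local_map (H H' : Type) (f : H -> H') X :
  local_fun X -> local_fun (fun n p c v => f (X n p c v)).
Proof. by move=> [g Hg]; exists (fun x => f (g x)) => n p c v; rewrite Hg. Qed.

Lemma local_map2 (H H' K : Type) (f : H -> H' -> K) X Y :
  local_fun X -> local_fun Y ->
  local_fun (fun n p c v => f (X n p c v) (Y n p c v)).
Proof.
move=> [g Hg] [h Hh]; exists (fun x => f (g x) (h x)) => n p c v.
by rewrite Hg Hh.
Qed.

Lemma local_ffun (I : finType) (H : Type)
    (X : I -> forall n, picture d S n -> (pt l n -> G) -> pt k n -> H) :
  (forall i, local_fun (X i)) ->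
  local_fun (fun n p c v => [ffun i => X i n p c v]).
Proof.
move=> HX; have [f Hf] := fin_all_exists HX.
exists (fun x => [ffun i => f i x]) => n p c v.
by apply/ffunP => i; rewrite !ffunE Hf.
Qed.

Lemma local_forall (I : finType)
    (X : I -> forall n, picture d S n -> (pt l n -> G) -> pt k n -> bool) :
  (forall i, local_fun (X i)) ->
  local_fun (fun n p c v => [forall i, X i n p c v]).
Proof.
move=> HX; have [f Hf] := fin_all_exists HX.
exists (fun x => [forall i, f i x]) => n p c v.
by apply: eq_forallb => i; rewrite Hf.
Qed.

Lemma local_if (H : Type) X Y Z :
  local_fun X -> local_fun Y -> local_fun Z ->
  local_fun (fun n p c v => if X n p c v then Y n p c v else Z n p c v : H).
Proof.
move=> [f Hf] [g Hg] [h Hh]; exists (fun x => if f x then g x else h x).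
by move=> n p c v; rewrite Hf Hg Hh.
Qed.

Lemma local_eq (H : Type) X Y :
  (forall n p c v, X n p c v = Y n p c v :> H) -> local_fun Y -> local_fun X.
Proof. by move=> E [f Hf]; exists f => n p c v; rewrite E. Qed.

Lemma local_color (w : {ffun 'I_l -> sterm k M}) : local_fun (fun n p c v => c (act w v)).
Proof. by exists (fun x : view_type => x.1.1.1 w) => n p c v; rewrite ffunE. Qed.

Lemma local_pic (w : {ffun 'I_d -> sterm k M}) : local_fun (fun n p c v => p (pt_tuple (act w v))).
Proof. by exists (fun x : view_type => x.1.1.2 w) => n p c v; rewrite ffunE. Qed.

Lemma local_min (w : sterm k M) : local_fun (fun n p c v => seval v w == ord0).
Proof. by exists (fun x : view_type => (x.1.2 w).1) => n p c v; rewrite ffunE. Qed.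

Lemma local_max (w : sterm k M) : local_fun (fun n p c v => seval v w == ord_max).
Proof. by exists (fun x : view_type => (x.1.2 w).2) => n p c v; rewrite ffunE. Qed.

Lemma local_lt (w w' : sterm k M) :
  local_fun (fun n p c v => seval v w < seval v w')%N.
Proof. by exists (fun x : view_type => (x.2 (w, w')).1) => n p c v; rewrite ffunE. Qed.

Lemma local_eqt (w w' : sterm k M) : local_fun (fun n p c v => seval v w == seval v w').
Proof. by exists (fun x : view_type => (x.2 (w, w')).2) => n p c v; rewrite ffunE. Qed.

End View.

Lemma local_recolor d k l M (S G G' : finType) (h : G' -> G) (H : Type)
    (X : forall n, picture d S n -> (pt l n -> G) -> pt k n -> H) :
  local_fun M X -> local_fun M (fun n p c v => X n p (fun x => h (c x)) v).
Proof.
move=> [f Hf]; exists (fun x : view_type d k l M S G' =>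
  f ([ffun w => h (x.1.1.1 w)], x.1.1.2, x.1.2, x.2)) => n p c v.
rewrite Hf /view /=; congr (f (_, _, _, _)).
by apply/ffunP => w; rewrite !ffunE.
Qed.

(** [k] counts universal variables and [l] is the arity of the guess; they are kept apart because
    the second separation needs [k = d + 1] with [l = d]. *)
Definition colorable (d k l : nat) : lang_class d := fun S L =>
  exists (G : finType) (M : nat) (f : view_type d k l M S G -> bool),
    forall n (p : picture d S n),
      L n p <-> exists c : pt l n -> G, forall v : pt k n, f (view M p c v).

Lemma colorable_local d k l M (S G : finType) (L : language d S)
    (X : forall n, picture d S n -> (pt l n -> G) -> pt k n -> bool) :
  local_fun M X ->
  (forall n p, L n p <-> exists c, forall v, X n p c v) -> colorable k l L.
Proof.
move=> [f Hf] HL; exists G, M, f => n p; rewrite HL.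
by split=> -[c Hc]; exists c => v; move: (Hc v); rewrite Hf.
Qed.

Lemma sat_forall_all d S k m (ar : 'I_m -> nat) (M : structure d S)
    (R : forall j, {set (ar j).-tuple M}) (f : formula d S k ar) :
  (forall v : 'I_k -> M, sat R v (forall_all f)) <->
  (forall v : 'I_k -> M, sat R v f).
Proof.
rewrite /forall_all; split=> H v.
  move: (H v); elim: (enum 'I_k) v => //= x s IH v /forallP /(_ (v x)) Hv.
  apply: IH; move: Hv; congr (is_true (sat _ _ _)).
  by apply: functional_extensionality => y; rewrite /upd; case: eqP => // ->.
by elim: (enum 'I_k) v => //= x s IH v; apply/forallP => a; apply: IH.
Qed.

Lemma fv_forall_all d S k m (ar : 'I_m -> nat) (f : formula d S k ar) :
  fv (forall_all f) = set0.
Proof.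
apply/setP => x; rewrite inE /forall_all.
have : x \in enum 'I_k by rewrite mem_enum.
elim: (enum 'I_k) => //= y s IH; rewrite !inE.
by case: (x =P y) => //= _ /IH.
Qed.

Lemma ESO_forall_var d k l : class_sub (@ESO_forall d k l) (@ESO_var d k).
Proof.
move=> S L [Phi [_ [th _ E] HL]]; exists Phi; split=> //.
by rewrite E fv_forall_all.
Qed.

Lemma ESO_forall_arity d k l l' : (l <= l')%N ->
  class_sub (@ESO_forall d k l) (@ESO_forall d k l').
Proof.
move=> ll S L [Phi [Har Hth HL]]; exists Phi; split=> // j.
exact: leq_trans (Har j) ll.
Qed.

(** * From local conditions to formulas *)

Section Definability.

Variables (d k : nat) (S : finType) (m : nat) (ar : 'I_m -> nat).

Definition ctx_fun (H : Type) :=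
  forall n (p : picture d S n),
    (forall j, {set (ar j).-tuple (coord p)}) -> ('I_k -> coord p) -> H.

Definition qf_pred (X : ctx_fun bool) : Prop :=
  exists2 th : formula d S k ar, qfree th &
    forall n p R v, @sat d S (coord p) k m ar R v th = X n p R v.

Definition qf_fun (H : finType) (X : ctx_fun H) : Prop :=
  forall h : H, qf_pred (fun n p R v => X n p R v == h).

Lemma qf_not X : qf_pred X -> qf_pred (fun n p R v => ~~ X n p R v).
Proof. by move=> [t qt Ht]; exists (FNot t) => //= n p R v; rewrite Ht. Qed.

Lemma qf_and X Y : qf_pred X -> qf_pred Y ->
  qf_pred (fun n p R v => X n p R v && Y n p R v).
Proof.
move=> [t qt Ht] [u qu Hu]; exists (FAnd t u) => /=; first by rewrite qt.
by move=> n p R v; rewrite Ht Hu.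
Qed.

Lemma qf_or X Y : qf_pred X -> qf_pred Y ->
  qf_pred (fun n p R v => X n p R v || Y n p R v).
Proof.
move=> [t qt Ht] [u qu Hu]; exists (FOr t u) => /=; first by rewrite qt.
by move=> n p R v; rewrite Ht Hu.
Qed.

Lemma qf_eq X Y : (forall n p R v, X n p R v = Y n p R v) ->
  qf_pred Y -> qf_pred X.
Proof. by move=> E [t qt Ht]; exists t => // n p R v; rewrite E Ht. Qed.

Lemma qf_fun_eq (H : finType) (X Y : ctx_fun H) :
  (forall n p R v, X n p R v = Y n p R v) -> qf_fun Y -> qf_fun X.
Proof. by move=> E HY h; apply: qf_eq (HY h) => n p R v; rewrite E. Qed.

Hypothesis k_gt0 : (0 < k)%N.

Lemma qf_const b : qf_pred (fun n p R v => b).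
Proof.
pose x := TVar (Ordinal k_gt0).
by case: b; [exists (FEq x x)|exists (FNot (FEq x x))] => //= n p R v;
  rewrite eqxx.
Qed.

Lemma qf_has (I : Type) (s : seq I) (X : I -> ctx_fun bool) :
  (forall i, qf_pred (X i)) -> qf_pred (fun n p R v => has (fun i => X i n p R v) s).
Proof.
move=> HX; elim: s => [|i s IH] /=; first exact: qf_const.
exact: qf_or.
Qed.

Lemma qf_exists (I : finType) (X : I -> ctx_fun bool) :
  (forall i, qf_pred (X i)) -> qf_pred (fun n p R v => [exists i, X i n p R v]).
Proof.
move=> HX; apply: qf_eq (qf_has (enum I) HX) => n p R v.
apply/existsP/hasP => [[i Hi]|[i _ Hi]]; exists i => //.
by rewrite mem_enum.
Qed.

Lemma qf_forall (I : finType) (X : I -> ctx_fun bool) :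
  (forall i, qf_pred (X i)) -> qf_pred (fun n p R v => [forall i, X i n p R v]).
Proof.
move=> HX; have := qf_not (qf_exists (fun i => qf_not (HX i))).
apply: qf_eq => n p R v; rewrite negb_exists; apply: eq_forallb => i.
by rewrite negbK.
Qed.

Lemma qf_map (H : finType) (f : H -> bool) (X : ctx_fun H) :
  qf_fun X -> qf_pred (fun n p R v => f (X n p R v)).
Proof.
move=> HX.
have := qf_exists (fun h => qf_and (qf_const (f h)) (HX h)).
apply: qf_eq => n p R v; apply/idP/existsP => [fX|[h /andP[fh /eqP->]]] //.
by exists (X n p R v); rewrite fX eqxx.
Qed.

Lemma qf_fun_map (H H' : finType) (f : H -> H') (X : ctx_fun H) :
  qf_fun X -> qf_fun (fun n p R v => f (X n p R v)).
Proof. by move=> HX h; apply: (qf_map (fun x => f x == h)). Qed.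

Lemma qf_fun_bool (X : ctx_fun bool) : qf_pred X -> qf_fun X.
Proof.
move=> HX [].
  by apply: qf_eq HX => n p R v; rewrite eqb_id.
by apply: qf_eq (qf_not HX) => n p R v; rewrite eqbF_neg.
Qed.

Lemma qf_fun_pair (H H' : finType) (X : ctx_fun H) (Y : ctx_fun H') :
  qf_fun X -> qf_fun Y -> qf_fun (fun n p R v => (X n p R v, Y n p R v)).
Proof.
move=> HX HY [h h']; apply: qf_eq (qf_and (HX h) (HY h')) => n p R v.
by rewrite xpair_eqE.
Qed.

Lemma qf_fun_ffun (I H : finType) (X : I -> ctx_fun H) :
  (forall i, qf_fun (X i)) -> qf_fun (fun n p R v => [ffun i => X i n p R v]).
Proof.
move=> HX h; have := qf_forall (fun i => HX i (h i)).
apply: qf_eq => n p R v; apply/eqP/forallP => [<- i|E].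
  by rewrite ffunE.
by apply/ffunP => i; rewrite ffunE; apply/eqP.
Qed.

End Definability.

Fixpoint iter_term k (a : nat) (x : 'I_k) : term k :=
  if a is a'.+1 then TSucc (iter_term a' x) else TVar x.

Definition term_of k M (w : sterm k M) : term k := iter_term w.2 w.1.

Lemma teval_term_of d S n (p : picture d S n) k M (v : 'I_k -> coord p)
    (w : sterm k M) : teval v (term_of w) = seval [ffun i => v i] w.
Proof.
rewrite /term_of /seval; case: w => x [a /= _].
elim: a => [|a IH] /=; first by rewrite ffunE.
by rewrite IH.
Qed.

Section ColorableESO.

Variables (d k l M : nat) (S G : finType).
Hypothesis k_gt0 : (0 < k)%N.
Variable g0 : G.

Let ar (j : 'I_#|G|) := l.

(** The relations, one per colour, need not form a partition: some colour whose relation holds is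
    taken, and [g0] if there is none. Every choice of relations thus decodes to a colouring, and the
    formula needs no clause for disjointness or covering. *)
Definition decode n (p : picture d S n)
    (R : forall j, {set (ar j).-tuple (coord p)}) (x : pt l n) : G :=
  odflt g0 [pick g | (pt_tuple x : (ar (enum_rank g)).-tuple (coord p))
                       \in R (enum_rank g)].

Lemma qf_decode (w : {ffun 'I_l -> sterm k M}) :
  qf_fun (fun n p (R : forall j, {set (ar j).-tuple (coord p)}) v =>
    decode R (act w [ffun i => v i])).
Proof.
pose X n p (R : forall j, {set (ar j).-tuple (coord p)}) (v : 'I_k -> @coord d S n p) :=
  [ffun g => (pt_tuple (act w [ffun i => v i]) : (ar (enum_rank g)).-tuple (coord p))
                       \in R (enum_rank g)].
have HX : qf_fun X.
  apply: (qf_fun_ffun k_gt0) => g; apply: qf_fun_bool.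
  exists (@FR d S k #|G| ar (enum_rank g)
    (map_tuple (@term_of k M) [tuple w i | i < l])) => //= n p R v.
  f_equal; apply: eq_from_tnth => i.
  by rewrite !tnth_map !tnth_ord_tuple ffunE; exact: teval_term_of.
apply: qf_fun_eq (qf_fun_map k_gt0 (fun f : {ffun G -> bool} => odflt g0 [pick g | f g]) HX).
move=> n p R v; rewrite /decode; congr odflt; apply: eq_pick => g.
by rewrite /X ffunE.
Qed.

Lemma qf_view : qf_fun (fun n p (R : forall j, {set (ar j).-tuple (coord p)}) v =>
  view M p (decode R) [ffun i : 'I_k => v i]).
Proof.
apply: qf_fun_pair; [apply: qf_fun_pair; [apply: qf_fun_pair|]|];
  apply: (qf_fun_ffun k_gt0) => w.
- exact: qf_decode.
- move=> s; exists (FQ s (map_tuple (@term_of k M) [tuple w i | i < d])) => //=.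
  move=> n p R v; rewrite inE; congr (p _ == s).
  apply: eq_from_tnth => i.
  by rewrite !tnth_map !tnth_ord_tuple ffunE; exact: teval_term_of.
- apply: qf_fun_pair; apply: qf_fun_bool.
  + by exists (FMin (term_of w)) => //= n p R v; rewrite inE teval_term_of.
  + by exists (FMax (term_of w)) => //= n p R v; rewrite inE teval_term_of.
- apply: qf_fun_pair; apply: qf_fun_bool.
  + by exists (FLt (term_of w.1) (term_of w.2)) => //= n p R v; rewrite !teval_term_of.
  + by exists (FEq (term_of w.1) (term_of w.2)) => //= n p R v; rewrite !teval_term_of.
Qed.

Lemma colorable_view_ESO (f : view_type d k l M S G -> bool) (L : language d S) :
  (forall n (p : picture d S n),
    L n p <-> exists c : pt l n -> G, forall v : pt k n, f (view M p c v)) ->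
  ESO_forall k l L.
Proof.
move=> HL; have [th qth Hth] := qf_map k_gt0 f qf_view.
exists (@ESO d S k #|G| ar (forall_all th)); split=> //; first by exists th.
move=> n p; rewrite HL /models /=; split.
  move=> [c Hc]; exists (fun j => [set x | c (tuple_pt x) == enum_val j]).
  apply: (proj2 (@sat_forall_all d S k _ ar (coord p) _ th)) => v; rewrite Hth.
  set D := decode _; suff -> : D = c by [].
  apply: functional_extensionality => x; rewrite /D /decode.
  case: pickP => [g|/(_ (c x))] /=; rewrite inE pt_tupleK enum_rankK ?eqxx //.
  by move/eqP.
move=> [R /(proj1 (@sat_forall_all d S k _ ar (coord p) _ th)) HR]; exists (@decode n p R) => v.
move: (HR v); rewrite Hth; congr (is_true (f (view _ _ _ _))).
by apply/ffunP => i; rewrite ffunE.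
Qed.

End ColorableESO.

Lemma colorable_ESO d k l : (0 < k)%N ->
  class_sub (@colorable d k l) (@ESO_forall d k l).
Proof.
move=> k_gt0 S L [G [M [f HL]]].
case: (pickP (fun _ : G => true)) => [g0 _|G0]; first exact: colorable_view_ESO g0 _ _ HL.
(* With [G] empty no point can be coloured, so [L] is empty and a false formula without relations
   defines it. *)
have [//|th qth Hth] := @qf_const d k S 0 (fun=> 0) _ false.
exists (@ESO d S k 0 (fun=> 0%N) (forall_all th)); split=> //.
  by exists th.
move=> n p; rewrite HL; split=> [[c _]|].
  by have := G0 (c [ffun=> ord0]).
move=> [R /(proj1 (@sat_forall_all d S k _ _ (coord p) _ th)) H].
by have := H (fun=> ord0); rewrite Hth.
Qed.

(** * Quantifier elimination by guessing subformulas *)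

Definition set_pt k n (x : pt k n) (j : 'I_k) (a : 'I_n.+1) : pt k n :=
  [ffun i => if i == j then a else x i].

Definition next_pt k n (x : pt k n) (j : 'I_k) : pt k n :=
  set_pt x j (ordS (x j)).

Lemma set_ptE k n (x : pt k n) j a i :
  set_pt x j a i = if i == j then a else x i.
Proof. by rewrite ffunE. Qed.

Lemma set_pt_id k n (x : pt k n) j : set_pt x j (x j) = x.
Proof. by apply/ffunP => i; rewrite ffunE; case: eqP => // ->. Qed.

Lemma set_pt_set k n (x : pt k n) j a b :
  set_pt (set_pt x j a) j b = set_pt x j b.
Proof. by apply/ffunP => i; rewrite !ffunE; case: eqP. Qed.

Lemma next_set_pt k n (x : pt k n) j a :
  next_pt (set_pt x j a) j = set_pt x j (ordS a).
Proof. by rewrite /next_pt set_pt_set set_ptE eqxx. Qed.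

Lemma val_ordS n (i : 'I_n.+1) : i != ord_max -> ordS i = i.+1 :> nat.
Proof.
move=> Hi; rewrite /= modn_small //.
by have := ltn_ord i; move: Hi; rewrite -val_eqE /= => /eqP; lia.
Qed.

Lemma ordS_max n : ordS (@ord_max n) = ord0.
Proof. by apply/val_inj; rewrite /= modnn. Qed.

Lemma ord_succ_ind n (P : 'I_n.+1 -> Prop) :
  P ord0 -> (forall i, i != ord_max -> P i -> P (ordS i)) -> forall i, P i.
Proof.
move=> P0 PS [a Ha]; elim: a Ha => [|a IH] Ha.
  by move: P0; congr (P _); apply/val_inj.
have Ha' : (a < n.+1)%N by lia.
have := PS (Ordinal Ha') _ (IH Ha'); rewrite -val_eqE /= => H.
have : P (ordS (Ordinal Ha')) by apply: H; lia.
by congr (P _); apply/val_inj => /=; rewrite modn_small.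
Qed.

(** Only steps that do not wrap around are assumed; they connect every value of the coordinate [j]
    to [ord0], where both sides are compared. *)
Lemma const_along k n (T : Type) (f : pt k n -> T) (j : 'I_k) :
  (forall x : pt k n, x j != ord_max -> f x = f (next_pt x j)) ->
  forall x a, f (set_pt x j a) = f x.
Proof.
move=> Hf x a; transitivity (f (set_pt x j ord0)).
  elim/ord_succ_ind: a => // a am <-.
  by rewrite -(next_set_pt x j a) -Hf // set_ptE eqxx.
rewrite -[in RHS](set_pt_id x j); move: (x j) => b.
elim/ord_succ_ind: b => // b bm ->.
by rewrite -(next_set_pt x j b) -Hf // set_ptE eqxx.
Qed.

Lemma const_off k n (T : Type) (f : pt k n -> T) (A : pred 'I_k) :
  (forall i, A i -> forall x a, f (set_pt x i a) = f x) ->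
  forall x y : pt k n, (forall i, ~~ A i -> x i = y i) -> f x = f y.
Proof.
move=> Hf x y; have [r] := ubnP #|[set i | x i != y i]|.
elim: r x => // r IH x Hr E.
have [/eqP|[i]] := set_0Vmem [set i | x i != y i].
  rewrite -subset0 => /subsetP H; congr f; apply/ffunP => i.
  by apply/eqP; apply: contraT => Hi; have := H i; rewrite !inE => /(_ Hi).
rewrite inE => Hi; rewrite -(Hf i _ x (y i)); last first.
  by apply: contraT => /E xy; rewrite xy eqxx in Hi.
apply: IH => [|i' Hi']; last by rewrite ffunE; case: eqP => [->|_] //; apply: E.
rewrite -ltnS; apply: leq_trans Hr; rewrite ltnS; apply: proper_card.
apply/properP; split; last by exists i; rewrite !inE // ffunE !eqxx.
by apply/subsetP => i'; rewrite !inE ffunE; case: (i' =P i) => [->|//]; rewrite eqxx.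
Qed.

Section ShiftMaps.

Variables (k M : nat).
Hypothesis M_gt0 : (0 < M)%N.

Definition id_map : {ffun 'I_k -> sterm k M} := [ffun i => (i, ord0)].

Definition next_map (j : 'I_k) : {ffun 'I_k -> sterm k M} :=
  [ffun i => (i, if i == j then inord 1 else ord0)].

Lemma act_id n (v : pt k n) : act id_map v = v.
Proof. by apply/ffunP => i; rewrite !ffunE. Qed.

Lemma act_next j n (v : pt k n) : act (next_map j) v = next_pt v j.
Proof.
apply/ffunP => i; rewrite !ffunE /seval /=; case: eqP => [->|//] /=.
by rewrite inordK.
Qed.

End ShiftMaps.

Section Scott.

Variables (d k M : nat) (S G0 : finType).
Hypothesis M_gt0 : (0 < M)%N.

(** Mere existence of a suitable [c] would certify [X] on one side only. Requiring every admissible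
    [c] to decode exactly to [X] makes the notion closed under negation, so alternating quantifiers
    cause no difficulty. *)
Definition guessable
    (X : forall n, picture d S n -> (pt k n -> G0) -> pt k n -> bool) : Prop :=
  exists (G : finType) (b : G -> bool)
    (Q : forall n, picture d S n -> (pt k n -> G0 * G) -> pt k n -> bool),
    local_fun M Q /\
    forall n p c0,
      (exists c, forall v, Q n p (fun x => (c0 x, c x)) v) /\
      (forall c, (forall v, Q n p (fun x => (c0 x, c x)) v) ->
         forall v, b (c v) = X n p c0 v).

Lemma local_self (G : finType) :
  local_fun M (fun n (p : picture d S n) (c : pt k n -> G) v => c v).
Proof.
apply: local_eq (local_color d S G (id_map k M)) => n p c v.
by rewrite act_id.
Qed.

Lemma local_next (G : finType) j :
  local_fun M (fun n (p : picture d S n) (c : pt k n -> G) v => c (next_pt v j)).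
Proof.
apply: local_eq (local_color d S G (next_map M j)) => n p c v.
by rewrite act_next.
Qed.

Lemma local_is_min l (G : finType) (j : 'I_k) :
  local_fun M (fun n (p : picture d S n) (c : pt l n -> G) (v : pt k n) => v j == ord0).
Proof. exact: (local_min d l S G ((j, ord0) : sterm k M)). Qed.

Lemma local_is_max l (G : finType) (j : 'I_k) :
  local_fun M (fun n (p : picture d S n) (c : pt l n -> G) (v : pt k n) => v j == ord_max).
Proof. exact: (local_max d l S G ((j, ord0) : sterm k M)). Qed.

Lemma guessable_local X : local_fun M X -> guessable X.
Proof.
move=> HX; exists bool, id.
exists (fun n p c v => (c v).2 == X n p (fun x => (c x).1) v); split.
  apply: (local_map2 (fun a b : bool => a == b)).
    exact: (local_map snd (@local_self (G0 * bool)%type)).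
  exact: local_recolor.
move=> n p c0; split; first by exists (X n p c0) => v /=.
by move=> c Hc v; apply/eqP/Hc.
Qed.

Lemma guessable_not X :
  guessable X -> guessable (fun n p c v => ~~ X n p c v).
Proof.
move=> [G [b [Q [HQ H]]]]; exists G, (negb \o b), Q; split=> // n p c0.
have [H1 H2] := H n p c0; split=> // c Hc v /=.
by rewrite (H2 c Hc).
Qed.

Lemma guessable_op (op : bool -> bool -> bool) X Y :
  guessable X -> guessable Y ->
  guessable (fun n p c v => op (X n p c v) (Y n p c v)).
Proof.
move=> [G [b [Q [HQ H]]]] [G' [b' [Q' [HQ' H']]]].
exists (G * G')%type, (fun g => op (b g.1) (b' g.2)).
exists (fun n p c v => Q n p (fun x => ((c x).1, (c x).2.1)) v &&
                       Q' n p (fun x => ((c x).1, (c x).2.2)) v); split.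
  apply: (local_map2 andb).
    exact: (local_recolor (fun g : G0 * (G * G') => (g.1, g.2.1))).
  exact: (local_recolor (fun g : G0 * (G * G') => (g.1, g.2.2))).
move=> n p c0; have [[c Hc] U] := H n p c0; have [[c' Hc'] U'] := H' n p c0.
split; first by exists (fun x => (c x, c' x)) => v /=; rewrite Hc Hc'.
move=> e He v.
rewrite (U (fun x => (e x).1)) ?(U' (fun x => (e x).2)) // => u.
  by have /andP[] := He u.
by have /andP[] := He u.
Qed.

(* The first extra bit of a colour tells whether a witness exists up to the
   current value of the quantified variable, the second one whether it exists
   at all. *)
Lemma guessable_ex (j : 'I_k) X :
  guessable X ->
  guessable (fun n p c v => [exists a, X n p c (set_pt v j a)]).
Proof.
move=> [G [b [Q [HQ H]]]].
exists (G * (bool * bool))%type, (fun g => g.2.2).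
exists (fun n p c v =>
  [&& Q n p (fun x => ((c x).1, (c x).2.1)) v,
   (v j == ord0) ==> ((c v).2.2.1 == b (c v).2.1),
   (if v j == ord_max then (c v).2.2.2 == (c v).2.2.1
    else (c (next_pt v j)).2.2.1 ==
         (c v).2.2.1 || b (c (next_pt v j)).2.1) &
   ((c (next_pt v j)).2.2.2 == (c v).2.2.2)]); split.
  have Lc := @local_self (G0 * (G * (bool * bool)))%type.
  have Ln := @local_next (G0 * (G * (bool * bool)))%type j.
  apply: (local_map2 andb).
    exact: (local_recolor (fun g : G0 * (G * (bool * bool)) => (g.1, g.2.1))).
  apply: (local_map2 andb).
    apply: (local_map2 implb); first exact: local_is_min.
    exact: (local_map (fun g => g.2.2.1 == b g.2.1) Lc).
  apply: (local_map2 andb); last first.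
    exact: (local_map2 (fun g h => g.2.2.2 == h.2.2.2) Ln Lc).
  apply: local_if; first exact: local_is_max.
    exact: (local_map (fun g => g.2.2.2 == g.2.2.1) Lc).
  exact: (local_map2 (fun g h => g.2.2.1 == h.2.2.1 || b g.2.1) Ln Lc).
move=> n p c0; have [[c Hc] U] := H n p c0; split.
  exists (fun x => (c x, ([exists a : 'I_n.+1, (a <= x j)%N && b (c (set_pt x j a))],
                        [exists a, b (c (set_pt x j a))]))) => v /=.
  rewrite Hc /=; apply/and3P; split.
  - apply/implyP => /eqP v0; apply/eqP; apply/existsP/idP => [[a /andP[]]|bv].
      rewrite v0 leqn0 => /eqP a0.
      suff -> : a = v j by rewrite set_pt_id.
      by rewrite v0; apply/val_inj.
    by exists (v j); rewrite leqnn set_pt_id.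
  - case: ifPn => [/eqP->|vm].
      by apply/eqP; apply: eq_existsb => a; rewrite -ltnS ltn_ord.
    apply/eqP; apply/existsP/orP => [[a]|].
      rewrite set_ptE eqxx set_pt_set val_ordS // leq_eqVlt ltnS.
      case/andP=> /orP[/eqP ea ba|la ba].
        right; move: ba; congr (is_true (b (c _))).
        by rewrite /next_pt; congr set_pt; apply/val_inj; apply: etrans ea (esym (val_ordS vm)).
      by left; apply/existsP; exists a; rewrite la.
    case=> [/existsP[a /andP[la ba]]|bn].
      exists a; rewrite set_ptE eqxx set_pt_set ba andbT val_ordS //.
      exact: leqW.
    exists (ordS (v j)); rewrite set_ptE eqxx leqnn /=.
    by rewrite set_pt_set.
  - apply/eqP; apply: eq_existsb => a.
    by rewrite /next_pt set_pt_set.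
move=> e He v.
have HX x : b (e x).1 = X n p c0 x.
  by apply: (U (fun x => (e x).1)) => u; have /and4P[] := He u.
have HE x a : (e (set_pt x j a)).2.2 = (e x).2.2.
  apply: (@const_along k n _ (fun x => (e x).2.2)) => y _.
  by have /and4P[_ _ _ /eqP->] := He y.
(* The first bit is the disjunction over the values up to [a]; at [ord_max] it is the full
   disjunction, and the second bit, constant along [j], carries it everywhere. *)
have HW a : (e (set_pt v j a)).2.1 =
    [exists a' : 'I_n.+1, (a' <= a)%N && X n p c0 (set_pt v j a')].
  elim/ord_succ_ind: a => [|a am IH].
    have /and4P[_ /implyP H0 _ _] := He (set_pt v j ord0).
    rewrite /= set_ptE !eqxx in H0; rewrite (eqP (H0 isT)) HX.
    apply/idP/existsP => [Xa|[a /andP[]]]; first by exists ord0.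
    rewrite leqn0 => /eqP a0 Xa.
    by have -> : ord0 = a by apply/val_inj.
  have /and4P[_ _ H1 _] := He (set_pt v j a).
  rewrite [X in is_true X]/= set_ptE eqxx (negPf am) next_set_pt in H1.
  rewrite (eqP H1) IH HX.
  apply/orP/existsP.
    case=> [/existsP[a' /andP[la Xa]]|Xa].
      by exists a'; rewrite Xa andbT val_ordS //; lia.
    by exists (ordS a); rewrite leqnn.
  move=> [a' /andP[]]; rewrite val_ordS // leq_eqVlt => /orP[/eqP ea Xa|la Xa].
    right; suff -> : ordS a = a' by [].
    by apply/val_inj; apply: etrans (val_ordS am) (esym ea).
  by left; apply/existsP; exists a'; rewrite Xa andbT.
rewrite -(HE v ord_max).
have /and4P[_ _ + _] := He (set_pt v j ord_max).
rewrite /= set_ptE !eqxx => /eqP->; rewrite HW.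
by apply: eq_existsb => a; rewrite -ltnS ltn_ord.
Qed.

End Scott.

(** * Reduction of the arities of guessed relations *)

Fixpoint tdepth k (t : term k) : nat :=
  if t is TSucc t' then (tdepth t').+1 else 0.

Definition tval_pt k n (v : pt k n) (t : term k) : 'I_n.+1 :=
  iter (tdepth t) (@ordS n.+1) (v (tvar t)).

Lemma teval_pt d S n (p : picture d S n) k (v : 'I_k -> coord p) (t : term k) :
  teval v t = tval_pt [ffun i => v i] t.
Proof.
elim: t => [x|t IH] /=; first by rewrite /tval_pt /= ffunE.
by rewrite IH.
Qed.

Fixpoint fdepth d S k m (ar : 'I_m -> nat) (f : formula d S k ar) : nat :=
  match f with
  | FEq t u | FLt t u => maxn (tdepth t) (tdepth u)
  | FMin t | FMax t => tdepth t
  | FQ _ ts => \max_(t <- ts) tdepth t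
  | FR _ ts => \max_(t <- ts) tdepth t
  | FNot g => fdepth g
  | FAnd g h | FOr g h => maxn (fdepth g) (fdepth h)
  | FAll x g | FEx x g => fdepth g
  end.

(** Arguments are plain sequences, so that atoms of different arities live in one type and compare
    without casts. *)
Definition ratom (k m : nat) := ('I_m * seq (term k))%type.

Fixpoint covered d S k m (ar : 'I_m -> nat) (I : Type) (at_ : I -> ratom k m)
    (f : formula d S k ar) : Prop :=
  match f with
  | FR j ts => exists i, at_ i = (j, tval ts)
  | FNot g => covered at_ g
  | FAnd g h | FOr g h => covered at_ g /\ covered at_ h
  | FAll x g | FEx x g => covered at_ g
  | _ => True
  end.

Lemma coveredW d S k m (ar : 'I_m -> nat) (I I' : Type) (at_ : I -> ratom k m)
    (at' : I' -> ratom k m) (f : formula d S k ar) :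
  (forall i, exists i', at_ i = at' i') -> covered at_ f -> covered at' f.
Proof.
move=> HI; elim: f => //=.
- by move=> j ts [i Hi]; have [i' Hi'] := HI i; exists i'; rewrite -Hi'.
- by move=> g Hg h Hh [/Hg ? /Hh ?].
- by move=> g Hg h Hh [/Hg ? /Hh ?].
Qed.

Lemma all_leq_bigmax (T : Type) (f : T -> nat) (s : seq T) m :
  (\max_(t <- s) f t <= m)%N -> all (fun t => f t <= m)%N s.
Proof.
elim: s => //= t s IH; rewrite big_cons geq_max => /andP[-> /=].
exact: IH.
Qed.

Lemma covered_exists d S k m (ar : 'I_m -> nat) (f : formula d S k ar) :
  exists (I : finType) (at_ : I -> ratom k m),
    covered at_ f /\
    forall i, size (at_ i).2 = ar (at_ i).1 /\
              all (fun t => tdepth t <= fdepth f)%N (at_ i).2.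
Proof.
have binary g h : (exists (I : finType) (at_ : I -> ratom k m),
    covered at_ g /\
    forall i, size (at_ i).2 = ar (at_ i).1 /\
              all (fun t => tdepth t <= fdepth g)%N (at_ i).2) ->
  (exists (I : finType) (at_ : I -> ratom k m),
    covered at_ h /\
    forall i, size (at_ i).2 = ar (at_ i).1 /\
              all (fun t => tdepth t <= fdepth h)%N (at_ i).2) ->
  exists (I : finType) (at_ : I -> ratom k m),
    (@covered d S k m ar I at_ g /\ covered at_ h) /\
    forall i, size (at_ i).2 = ar (at_ i).1 /\
              all (fun t => tdepth t <= maxn (fdepth g) (fdepth h))%N (at_ i).2.
  move=> [I [a [ca Ha]]] [J [b [cb Hb]]].
  exists (I + J)%type, (fun i => match i with inl i => a i | inr j => b j end).
  split; first split.
  - by apply: coveredW ca => i; exists (inl i).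
  - by apply: coveredW cb => i; exists (inr i).
  - case=> [i|j]; [have [-> H] := Ha i|have [-> H] := Hb j]; split=> //.
      by apply: sub_all H => t; lia.
    by apply: sub_all H => t; lia.
elim: f => /=; try by (do ?move=> ?); exists void, (of_void _); split=> // -[].
- move=> j ts; exists unit, (fun=> (j, tval ts)); split; first by exists tt.
  by move=> _ /=; rewrite size_tuple; split=> //; apply: all_leq_bigmax.
- by [].
- by move=> g Hg h Hh; apply: binary.
- by move=> g Hg h Hh; apply: binary.
- by move=> _ g Hg.
- by move=> _ g Hg.
Qed.

Section Realize.

Variables (d k m : nat) (S : finType) (ar : 'I_m -> nat).
Variables (I : finType) (at_ : I -> ratom k m) (M0 : nat).
Hypothesis at_size : forall i, size (at_ i).2 = ar (at_ i).1.
Hypothesis at_depth : forall i, all (fun t => tdepth t <= M0)%N (at_ i).2.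
Hypothesis k_gt0 : (0 < k)%N.

(** In [consistent_eq] a variable is shifted by up to [2 * M0], from [M0] steps before a value to
    [M0] steps after it; the extra one keeps a unit step available when [M0 = 0]. The terms of an
    atom add up to [M0] further successors, whence [M]. *)
Let M1 := (2 * M0).+1.
Let M := (M1 + M0)%N.

Let atoms_color : finType := {ffun I -> bool}.

Definition in_rel (T : finType) (R : forall j, {set (ar j).-tuple T}) j
    (s : seq T) : bool :=
  if insub s is Some t then t \in R j else false.

Definition atom_val n (i : I) (v : pt k n) : seq 'I_n.+1 :=
  map (tval_pt v) (at_ i).2.

Definition realizes n (R : forall j, {set (ar j).-tuple 'I_n.+1})
    (c : pt k n -> atoms_color) : Prop :=
  forall i v, c v i = in_rel R (at_ i).1 (atom_val i v).

(* All instances of the compatibility of the guessed atoms with equalities that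
   involve only the variables of z.  As succ is bijective, two atoms with equal
   values have their variables related by shifts, so nothing is lost. *)
Definition consistent n (p : picture d S n) (c : pt k n -> atoms_color)
    (z : pt k n) : bool :=
  [forall i, [forall i', [forall w : {ffun 'I_k -> sterm k M1},
    [forall w' : {ffun 'I_k -> sterm k M1},
      ((at_ i).1 == (at_ i').1) &&
      (atom_val i (act w z) == atom_val i' (act w' z)) ==>
      (c (act w z) i == c (act w' z) i')]]]].

Definition sterm_of (t : term k) (w : {ffun 'I_k -> sterm k M1}) : sterm k M :=
  ((w (tvar t)).1, inord (tdepth t + (w (tvar t)).2)).

Lemma seval_sterm_of n (z : pt k n) t w : (tdepth t <= M0)%N ->
  seval z (sterm_of t w) = tval_pt (act w z) t.
Proof.
move=> Ht; rewrite /seval /tval_pt /= ffunE /seval inordK ?iterD //.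
by rewrite ltnS addnC leq_add // -ltnS ltn_ord.
Qed.

Lemma local_eq_seq (l : nat) (G : finType) (s s' : seq (sterm k M)) :
  local_fun M (fun n (p : picture d S n) (c : pt l n -> G) (z : pt k n) =>
    map (seval z) s == map (seval z) s').
Proof.
elim: s s' => [|t s IH] [|t' s'] /=; try exact: local_const.
apply: local_eq (local_map2 andb (local_eqt d l S G t t') (IH s')).
by move=> n p c v; rewrite eqseq_cons.
Qed.

Lemma local_atom_color (w : {ffun 'I_k -> sterm k M1}) i :
  local_fun M (fun n (p : picture d S n) (c : pt k n -> atoms_color) z =>
    c (act w z) i).
Proof.
apply: (local_map (fun g : atoms_color => g i)).
have := local_color d S atoms_color
  [ffun j => ((w j).1, inord (w j).2) : sterm k M].
apply: local_eq => n p c z; congr c; apply/ffunP => j.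
rewrite !ffunE /seval /= inordK //; apply: leq_trans (ltn_ord _) _.
by rewrite ltnS leq_addr.
Qed.

Lemma local_consistent : local_fun M consistent.
Proof.
apply: local_forall => i; apply: local_forall => i'.
apply: local_forall => w; apply: local_forall => w'.
apply: (local_map2 implb); last first.
  by apply: (local_map2 (fun a b : bool => a == b)); apply: local_atom_color.
apply: (local_map2 andb); first exact: local_const.
have := local_eq_seq k atoms_color (map (sterm_of^~ w) (at_ i).2)
  (map (sterm_of^~ w') (at_ i').2).
apply: local_eq => n p c z; rewrite /atom_val -!map_comp.
have E (j : I) u : map (tval_pt (act u z)) (at_ j).2 =
    map (seval z \o sterm_of^~ u) (at_ j).2.
  have := at_depth j; elim: (at_ j).2 => //= t s IH /andP[Ht /IH ->].
  by rewrite seval_sterm_of.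
by rewrite !E.
Qed.

Lemma consistentP n (p : picture d S n) (c : pt k n -> atoms_color) z i i'
    (w w' : {ffun 'I_k -> sterm k M1}) :
  consistent p c z -> (at_ i).1 = (at_ i').1 ->
  atom_val i (act w z) = atom_val i' (act w' z) ->
  c (act w z) i = c (act w' z) i'.
Proof.
move=> /forallP/(_ i)/forallP/(_ i')/forallP/(_ w)/forallP/(_ w')/implyP H E1 E2.
by apply/eqP/H; rewrite E1 E2 !eqxx.
Qed.

Lemma eq_atom_val n i (v v' : pt k n) :
  (forall l, l \in map (@tvar k) (at_ i).2 -> v l = v' l) ->
  atom_val i v = atom_val i v'.
Proof.
rewrite /atom_val; elim: (at_ i).2 => //= t s IH H.
rewrite IH; last by move=> l Hl; apply: H; rewrite inE Hl orbT.
by congr cons; rewrite /tval_pt H // inE eqxx.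
Qed.

Section Consistent.

Variables (n : nat) (p : picture d S n) (c : pt k n -> atoms_color).
Hypothesis c_ok : forall z, consistent p c z.

(** Stepping a variable absent from the atom leaves its values unchanged, and a unit step is among
    the shifts that [consistent] compares. *)
Lemma consistent_unused i l : l \notin map (@tvar k) (at_ i).2 ->
  forall v a, c (set_pt v l a) i = c v i.
Proof.
move=> Hl; apply: (@const_along k n _ (fun v => c v i)) => v _.
have M1_gt0 : (0 < M1)%N by [].
rewrite -[in LHS](act_id M1 v) -(act_next M1_gt0 l v).
apply: consistentP => //; apply: eq_atom_val => l' Hl'.
rewrite act_id act_next // ffunE.
by case: eqP => // E; move: Hl; rewrite -E Hl'.
Qed.

Lemma consistent_ext i (v v' : pt k n) :
  (forall l, l \in map (@tvar k) (at_ i).2 -> v l = v' l) -> c v i = c v' i.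
Proof.
move=> E; apply: (@const_off k n _ (fun v => c v i)
  (fun l => l \notin map (@tvar k) (at_ i).2)) => [l Hl|l].
  exact: consistent_unused.
by rewrite negbK => /E.
Qed.

(** At each position, equal values mean that the variable in [i] is the one in [i'] shifted by the
    difference of the depths, because [ordS] is injective. Both valuations are therefore bounded
    shifts of one point [z], up to variables absent from [i]. *)
Lemma consistent_eq i i' v v' : (at_ i).1 = (at_ i').1 ->
  atom_val i v = atom_val i' v' -> c v i = c v' i'.
Proof.
move=> E1 E2.
(* Going back by [M0] makes all the required shifts nonnegative. *)
pose z : pt k n := [ffun l => iter M0 (@ord_pred n.+1) (v' l)].
have zK a l : iter (M0 + a) (@ordS n.+1) (z l) = iter a (@ordS n.+1) (v' l).
  rewrite addnC iterD ffunE; congr iter.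
  by elim: (M0) (v' l) => // r IH y; rewrite iterSr iterS ord_predK IH.
pose x0 : term k := TVar (Ordinal k_gt0).
pose w' : {ffun 'I_k -> sterm k M1} := [ffun l => (l, inord M0)].
pose pos l := index l (map (@tvar k) (at_ i).2).
pose t l := nth x0 (at_ i).2 (pos l).
pose t' l := nth x0 (at_ i').2 (pos l).
pose w : {ffun 'I_k -> sterm k M1} :=
  [ffun l => (tvar (t' l), inord (M0 + tdepth (t' l) - tdepth (t l)))].
have Ew' : act w' z = v'.
  apply/ffunP => l; rewrite !ffunE /seval /= inordK; last by rewrite /M1; lia.
  by rewrite -[M0]addn0 zK.
have Ew l : l \in map (@tvar k) (at_ i).2 -> act w z l = v l.
  move=> Hl; have := Hl; rewrite -index_mem size_map -/(pos l) => Hs.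
  have Hs' : (pos l < size (at_ i').2)%N by rewrite at_size -E1 -at_size.
  have Et : tvar (t l) = l by rewrite /t -(nth_map _ l) // nth_index.
  have Dt : (tdepth (t l) <= M0)%N by apply: (all_nthP x0 (at_depth i)).
  have Dt' : (tdepth (t' l) <= M0)%N by apply: (all_nthP x0 (at_depth i')).
  have := congr1 (fun s => nth ord0 s (pos l)) E2.
  rewrite /atom_val !(nth_map x0) // -/(t l) -/(t' l) /tval_pt Et => E.
  rewrite ffunE /seval ffunE /= inordK; last by rewrite /M1; lia.
  have iter_inj a : injective (iter a (@ordS n.+1)).
    by elim: a => // a IH y y' /= /ordS_inj /IH.
  apply: (iter_inj (tdepth (t l))).
  rewrite -iterD subnKC; last by lia.
  by rewrite zK.
transitivity (c (act w z) i).
  by apply: consistent_ext => l /Ew.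
rewrite -Ew'; apply: consistentP => //; rewrite Ew' -E2.
exact: eq_atom_val.
Qed.

(** Each relation collects the values of its true atoms; by [consistent_eq] no false atom of the
    same relation takes one of these values. *)
Lemma consistent_realizes :
  exists R : forall j, {set (ar j).-tuple 'I_n.+1}, realizes R c.
Proof.
exists (fun j => [set t | [exists i, [exists v : pt k n,
  [&& (at_ i).1 == j, atom_val i v == val t & c v i]]]]) => i v.
rewrite /in_rel.
have Hs : size (atom_val i v) == ar (at_ i).1 by rewrite size_map at_size.
rewrite insubT inE; apply/idP/existsP => [cv|[i' /existsP[v' /and3P[/eqP E1 /eqP E2 cv]]]].
  by exists i; apply/existsP; exists v; rewrite !eqxx cv.
by rewrite -(consistent_eq E1 E2).
Qed.

End Consistent.

Lemma realizes_consistent n (p : picture d S n) c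
    (R : forall j, {set (ar j).-tuple 'I_n.+1}) :
  realizes R c -> forall z, consistent p c z.
Proof.
move=> HR z; apply/forallP => i; apply/forallP => i'; apply/forallP => w.
apply/forallP => w'; apply/implyP => /andP[/eqP E1 /eqP E2].
by rewrite !HR E1 E2.
Qed.

Lemma guessable_formula (f : formula d S k ar) :
  (fdepth f <= M0)%N -> covered at_ f ->
  exists2 X, guessable M X &
    forall n (p : picture d S n) (R : forall j, {set (ar j).-tuple (coord p)}) c,
      realizes R c -> forall v, sat R v f = X n p c [ffun i => v i].
Proof.
pose st t := sterm_of t (id_map k M1).
have stE n (v : pt k n) t : (tdepth t <= M0)%N -> tval_pt v t = seval v (st t).
  by move=> Ht; rewrite seval_sterm_of // act_id.
have M_gt0 : (0 < M)%N by [].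
elim: f => /=.
- move=> t u; rewrite geq_max => /andP[Ht Hu] _.
  exists (fun n p c v => seval v (st t) == seval v (st u)).
    by apply: guessable_local => //; apply: local_eqt.
  by move=> n p R c _ v; rewrite !teval_pt !stE.
- move=> t u; rewrite geq_max => /andP[Ht Hu] _.
  exists (fun n p c v => seval v (st t) < seval v (st u))%N.
    by apply: guessable_local => //; apply: local_lt.
  by move=> n p R c _ v; rewrite !teval_pt !stE.
- move=> t Ht _; exists (fun n p c v => seval v (st t) == ord0).
    by apply: guessable_local => //; apply: local_min.
  by move=> n p R c _ v; rewrite inE teval_pt stE.
- move=> t Ht _; exists (fun n p c v => seval v (st t) == ord_max).
    by apply: guessable_local => //; apply: local_max.
  by move=> n p R c _ v; rewrite inE teval_pt stE.
- move=> s ts Hts _.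
  exists (fun n p c v => p (pt_tuple (act [ffun i => st (tnth ts i)] v)) == s).
    apply: guessable_local => //; apply: (local_map (fun x => x == s)).
    exact: local_pic.
  move=> n p R c _ v; rewrite inE; congr (p _ == s).
  apply: eq_from_tnth => i; rewrite tnth_map tnth_mktuple !ffunE teval_pt stE //.
  have/(all_nthP (tnth ts i)) H := all_leq_bigmax Hts.
  by rewrite (tnth_nth (tnth ts i)); apply: H; rewrite size_tuple.
- move=> j ts _ [i Hi]; exists (fun n p c v => c v i).
    apply: guessable_local => //; apply: (local_map (fun g : atoms_color => g i)).
    exact: local_self.
  move=> n p R c HR v; rewrite (HR i) /atom_val Hi /in_rel /=.
  have -> : map (tval_pt [ffun i0 => v i0]) ts = val (map_tuple (@teval d S (coord p) k v) ts).
    by apply: eq_map => t; rewrite teval_pt.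
  by rewrite valK.
- move=> g IH Hd Hc; have [X HX E] := IH Hd Hc.
  exists (fun n p c v => ~~ X n p c v); first exact: guessable_not.
  by move=> n p R c HR v; rewrite (E n p R c HR).
- move=> g IHg h IHh; rewrite geq_max => /andP[Hdg Hdh] [Hcg Hch].
  have [X HX E] := IHg Hdg Hcg; have [Y HY E'] := IHh Hdh Hch.
  exists (fun n p c v => X n p c v && Y n p c v); first exact: guessable_op.
  by move=> n p R c HR v; rewrite (E n p R c HR) (E' n p R c HR).
- move=> g IHg h IHh; rewrite geq_max => /andP[Hdg Hdh] [Hcg Hch].
  have [X HX E] := IHg Hdg Hcg; have [Y HY E'] := IHh Hdh Hch.
  exists (fun n p c v => X n p c v || Y n p c v); first exact: guessable_op.
  by move=> n p R c HR v; rewrite (E n p R c HR) (E' n p R c HR).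
- move=> x g IH Hd Hc; have [X HX E] := IH Hd Hc.
  exists (fun n p c v => ~~ [exists a, ~~ X n p c (set_pt v x a)]).
    apply/guessable_not/(guessable_ex _ _ (X := fun n p c v => ~~ X n p c v)) => //.
    exact: guessable_not.
  move=> n p R c HR v; rewrite negb_exists; apply: eq_forallb => a.
  rewrite negbK (E n p R c HR); congr (X n p c _).
  by apply/ffunP => i; rewrite !ffunE.
- move=> x g IH Hd Hc; have [X HX E] := IH Hd Hc.
  exists (fun n p c v => [exists a, X n p c (set_pt v x a)]).
    exact: guessable_ex.
  move=> n p R c HR v; apply: eq_existsb => a.
  rewrite (E n p R c HR); congr (X n p c _).
  by apply/ffunP => i; rewrite !ffunE.
Qed.

End Realize.

Lemma ESO_var_colorable d k : (0 < k)%N ->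
  class_sub (@ESO_var d k) (@colorable d k k).
Proof.
move=> k_gt0 S L [[m ar phi] [_ HL]].
have [I [at_ [cov Hat]]] := covered_exists phi.
have Hs i := (Hat i).1; have Hd i := (Hat i).2.
have [X HX EX] := @guessable_formula d k m S ar I at_ (fdepth phi) phi (leqnn _) cov.
have [G [b [Q [LQ HQ]]]] := HX.
have LC := @local_consistent d k m S I at_ (fdepth phi) Hd.
pose G0 : finType := {ffun I -> bool}.
apply: (@colorable_local d k k _ S (G0 * G)%type L (fun n p c v =>
  [&& consistent at_ (fdepth phi) p (fun x => (c x).1) v, Q n p c v & b (c v).2])).
- apply: (local_map2 andb).
    exact: (local_recolor (fun g : G0 * G => g.1) LC).
  apply: (local_map2 andb LQ).
  apply: (local_map (fun g : G0 * G => b g.2)); exact: local_self.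
move=> n p; rewrite HL; split.
  move=> [R HR].
  pose c0 (v : pt k n) : G0 := [ffun i => in_rel R (at_ i).1 (atom_val at_ i v)].
  have Hc0 : realizes at_ R c0 by move=> i v; rewrite ffunE.
  have [[c Hc] U] := HQ n p c0.
  exists (fun x => (c0 x, c x)) => v /=.
  rewrite (realizes_consistent (fdepth phi) p Hc0) Hc (U c Hc) /=.
  move: (HR (fun i => v i)); rewrite (EX n p R c0 Hc0) /=.
  by congr (is_true (X n p c0 _)); apply/ffunP => i; rewrite ffunE.
move=> [c Hc].
pose c0 v := (c v).1; pose c1 v := (c v).2.
have Ec : c = fun x => (c0 x, c1 x).
  by apply: functional_extensionality => x; rewrite /c0 /c1; case: (c x).
have [R HR] := @consistent_realizes d k m S ar I at_ _ Hs Hd k_gt0 n p c0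
  (fun z => let: And3 H _ _ := and3P (Hc z) in H).
exists R => v; rewrite /= (EX n p R c0 HR).
have [_ U] := HQ n p c0.
rewrite -(U c1); first by have /and3P[] := Hc [ffun i => v i].
by move=> u; have /and3P[_ + _] := Hc u; rewrite Ec.
Qed.

(** * Space-time tilings and cellular automata *)

Definition pt0 k n : pt k n := [ffun=> ord0].

Lemma bordered_neighbour d (G : finType) n (q : picture d G n) (a : pt d n) i :
  bordered q (neighbour (pt_tuple a) i) =
  if a i == ord_max then None else Some (q (pt_tuple (next_pt a i))).
Proof.
rewrite /bordered; case: eqP => [E|/eqP ne].
  case: ifP => // /forallP /(_ i).
  by rewrite /neighbour !tnth_mktuple E eqxx /= addn1 ltnn.
have lt_n : (a i < n)%N.
  by have := ltn_ord (a i); move: ne; rewrite -val_eqE /= => /eqP; lia.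
rewrite ifT; last first.
  apply/forallP => j; rewrite !tnth_mktuple; case: eqP => [->|_] /=.
    by rewrite addn1 /=; lia.
  by rewrite addn0 /=; exact: ltn_ord.
congr (Some (q _)); apply: eq_from_tnth => j; rewrite !tnth_mktuple ffunE.
apply/val_inj; rewrite /= inordK; last first.
  by case: eqP => [->|_]; rewrite ?addn1 ?addn0 //=; lia.
by case: eqP => [->|_]; rewrite ?addn1 ?addn0 // val_ordS.
Qed.

(** Time has no border symbol, since a cell cannot see when the run stops. Comparing the first and
    the last colour of the origin by [F] is the only access to the ends of time. *)
Definition st_tiling (d : nat) : lang_class d := fun S L =>
  exists (G : finType) (pi : G -> S) (E : 'I_d -> G -> option G -> bool)
    (Et F : G -> G -> bool),
  forall n (p : picture d S n), L n p <-> exists C : pt d n -> 'I_n.+1 -> G,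
    [/\ forall a t, pi (C a t) = p (pt_tuple a),
        forall a t i, E i (C a t)
          (if a i == ord_max then None else Some (C (next_pt a i) t)),
        forall a t, t != ord_max -> Et (C a t) (C a (ordS t))
      & F (C (pt0 d n) ord0) (C (pt0 d n) ord_max)].

Section TilingCA.

Variables (d : nat) (S G : finType) (pi : G -> S).
Variables (E : 'I_d -> G -> option G -> bool) (Et F : G -> G -> bool).

(* Every cell remembers its first colour, so that F can be tested at the
   origin when the run stops. *)
Let state : finType := (S + bool * (G * G))%type.

(** The constraints inside a configuration are checked while leaving it, so the last of the [N]
    configurations needs one more step, into a state tagged [true]. Such states have no successor,
    hence no cell enters one earlier. With the input this makes [N + 2] configurations. *)
Definition tca_delta (q : state) (nb : d.-tuple (option state)) : {set state} :=
  match q with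
  | inl s => [set x : state | if x is inr (false, (g0, g))
                              then (g0 == g) && (pi g == s) else false]
  | inr (true, _) => set0
  | inr (false, (g0, g)) =>
    if [forall i, match tnth nb i with
                  | None => E i g None
                  | Some (inr (false, (_, h))) => E i g (Some h)
                  | _ => false end]
    then [set x : state | match x with
                  | inr (false, (h0, h)) => [&& h0 == g0, pi h == pi g & Et g h]
                  | inr (true, h) => h == (g0, g)
                  | _ => false end]
    else set0
  end.

Definition tca : automaton d S :=
  @Automaton d S state inl (fun x y e => let: erefl := e in erefl) tca_delta
    [set x : state | if x is inr (true, (g0, g)) then F g0 g else false].

Lemma tca_accepts n (p : picture d S n) :
  ca_accepts tca n.+3 p <-> exists C : pt d n -> 'I_n.+1 -> G,
    [/\ forall a t, pi (C a t) = p (pt_tuple a),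
        forall a t i, E i (C a t)
          (if a i == ord_max then None else Some (C (next_pt a i) t)),
        forall a t, t != ord_max -> Et (C a t) (C a (ordS t))
      & F (C (pt0 d n) ord0) (C (pt0 d n) ord_max)].
Proof.
have t0E : [tuple ord0 | i < d] = pt_tuple (pt0 d n).
  by apply: eq_from_tnth => i; rewrite !tnth_mktuple ffunE.
split.
  case=> run [run1 step fin].
  have stepP t (a : pt d n) : (1 <= t < n.+3)%N ->
      run t.+1 (pt_tuple a) \in tca_delta (run t (pt_tuple a))
        [tuple bordered (run t) (neighbour (pt_tuple a) i) | i < d].
    by move=> Ht; apply: step.
  have shape (u : pt d n * 'I_n.+1) : exists gg, run u.2.+2 (pt_tuple u.1) = inr (false, gg).
    case: u => a [t Ht] /=; elim: t Ht => [|t IH] Ht.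
      have := stepP 1%N a isT; rewrite run1 ffunE /= inE.
      case: (run 2%N _) => // -[[] // gg] _.
      by exists gg.
    have [|[g0 g] Hg] := IH; first by lia.
    have Ht2 : (t.+2 < n.+3)%N by lia.
    have := stepP t.+2 a Ht2; rewrite Hg /=.
    case: ifP => _; rewrite inE //.
    have := stepP t.+3 a; case: (run t.+3 _) => // -[[|] gg] H3.
      by have := H3 Ht; rewrite inE.
    by move=> _; exists gg.
  have [u Hu] := fin_all_exists shape.
  have {}Hu a (t : 'I_n.+1) : run t.+2 (pt_tuple a) = inr (false, u (a, t)).
    exact: (Hu (a, t)).
  have nbE a (t : 'I_n.+1) i :
    bordered (run t.+2) (neighbour (pt_tuple a) i) =
    if a i == ord_max then None else Some (inr (false, u (next_pt a i, t))).
    by rewrite bordered_neighbour; case: ifP => // _; rewrite Hu.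
  have stepT a (t : 'I_n.+1) : run t.+3 (pt_tuple a) \in
      tca_delta (inr (false, u (a, t)))
        [tuple bordered (run t.+2) (neighbour (pt_tuple a) i) | i < d].
    by rewrite -Hu; apply: stepP; exact: ltn_ord t.
  have stepS a (t : 'I_n.+1) : t != ord_max -> inr (false, u (a, ordS t)) \in
      tca_delta (inr (false, u (a, t)))
        [tuple bordered (run t.+2) (neighbour (pt_tuple a) i) | i < d].
    by move=> tm; have := stepT a t; rewrite -(Hu a (ordS t)) (val_ordS tm).
  have u1 a t : (u (a, t)).1 = (u (a, ord0)).2 /\ pi (u (a, t)).2 = p (pt_tuple a).
    elim/ord_succ_ind: t => [|t tm [IH1 IH2]].
      have := stepP 1%N a isT; rewrite run1 ffunE /= inE (Hu a ord0).
      by case: (u _) => g0 g /andP[/eqP-> /eqP->].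
    have := stepS a t tm.
    case Eu : (u (a, t)) IH1 IH2 => [g0 g] /= IH1 IH2.
    case: ifP => _; rewrite inE //; case: (u (a, ordS t)) => h0 h /=.
    by case/and3P=> /eqP-> /eqP-> _.
  exists (fun a t => (u (a, t)).2); split.
  - by move=> a t; have [] := u1 a t.
  - move=> a t i; have := stepT a t.
    case: (u (a, t)) => g0 g /=; case: ifP; last by rewrite inE.
    move=> /forallP /(_ i); rewrite tnth_mktuple nbE; case: ifP => // _.
    by case: (u (next_pt a i, t)).
  - move=> a t tm; have := stepS a t tm.
    case: (u (a, t)) => g0 g /=.
    case: ifP => _; rewrite inE //; case: (u (a, ordS t)) => h0 h /=.
    by case/and3P.
  - have := stepT (pt0 d n) ord_max; rewrite /= -t0E; move: fin; rewrite /= inE.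
    have := u1 (pt0 d n) ord_max; case: (u (_, ord_max)) => g0 g /= [-> _].
    case: (run n.+3 _) => // -[[|//] [h0 h]] Fh.
    case: ifP => _; rewrite inE // => /eqP[<- <-].
    by [].
move=> [C [Hpi HE HEt HF]].
pose run t : picture d state n :=
  if (t <= 1)%N then [ffun a => inl (p a)]
  else if (t == n.+3)%N then [ffun a => inr (true, (C (tuple_pt a) ord0, C (tuple_pt a) ord_max))]
  else [ffun a => inr (false, (C (tuple_pt a) ord0, C (tuple_pt a) (inord t.-2)))].
exists run; split.
- by apply/ffunP => a; rewrite !ffunE.
- move=> [|[|t]] // /andP[_ Ht] a.
    rewrite /run /= !ffunE /= inE.
    have -> : (inord 0 : 'I_n.+1) = ord0 by apply/val_inj; rewrite /= inordK.
    by rewrite eqxx Hpi tuple_ptK eqxx.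
  have Ht' : (t < n.+1)%N by lia.
  rewrite {2}/run /= eqn_leq [(n.+3 <= _)%N]leqNgt Ht andbF /= ffunE /=.
  rewrite ifT; last first.
    apply/forallP => i; rewrite tnth_mktuple -[in neighbour a i](tuple_ptK a).
    rewrite bordered_neighbour; have := HE (tuple_pt a) (inord t) i.
    case: ifP => // _; rewrite /run /= eqn_leq [(n.+3 <= _)%N]leqNgt Ht andbF /=.
    by rewrite ffunE pt_tupleK.
  rewrite inE /run /=; case: eqP => [tn|ne]; rewrite ffunE.
    apply/eqP; congr (_, C _ _); apply/val_inj; rewrite /= inordK //.
    by lia.
  rewrite eqxx !Hpi eqxx /=.
  have lt_n : (t < n)%N by lia.
  have := HEt (tuple_pt a) (inord t); rewrite -val_eqE /= inordK // => H.
  have -> : (inord t.+1 : 'I_n.+1) = ordS (inord t).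
    apply/val_inj; rewrite /= !inordK ?ltnS //.
    by rewrite modn_small.
  by apply: H; lia.
- by rewrite /run /= eqxx inE ffunE t0E pt_tupleK.
Qed.

End TilingCA.

Lemma st_tiling_NLIN d : class_sub (@st_tiling d) (@NLIN_CA d).
Proof.
move=> S L [G [pi [E [Et [F HL]]]]].
exists (tca pi E Et F), 1%R, 2%R; split=> [n n_gt0|n p].
  by rewrite /lin_time; lia.
rewrite HL -tca_accepts; suff -> : `|lin_time 1 2 n.+1|%N = n.+3 by [].
by rewrite /lin_time; lia.
Qed.

(** * Moving values between coordinates *)

Definition comp_pt k r n (x : pt k n) (u : {ffun 'I_r -> 'I_k}) : pt r n :=
  [ffun s => x (u s)].

Lemma comp_pt_comp k r r' n (x : pt k n) (u : {ffun 'I_r -> 'I_k})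
    (v : {ffun 'I_r' -> 'I_r}) :
  comp_pt (comp_pt x u) v = comp_pt x [ffun s => u (v s)].
Proof. by apply/ffunP => s; rewrite !ffunE. Qed.

Definition misses k r (u : {ffun 'I_r -> 'I_k}) (e : 'I_k) : bool :=
  [forall s, u s != e].

Lemma comp_set_pt k r n (x : pt k n) (u : {ffun 'I_r -> 'I_k}) e a :
  misses u e -> comp_pt (set_pt x e a) u = comp_pt x u.
Proof.
move=> /forallP H; apply/ffunP => s; rewrite !ffunE.
by rewrite (negPf (H s)).
Qed.

(* The values of y are tokens lying on the places 1, ..., k, one of which is
   free; moving a token to the free place is a change of an unused coordinate
   followed by a change of name. *)
Section Tokens.

Variables (k r n : nat) (T : Type) (H : {ffun 'I_r -> 'I_k} -> pt k n -> T).
Hypothesis H_unused : forall u e, misses u e ->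
  forall x a, H u (set_pt x e a) = H u x.
Hypothesis H_tie : forall u u' x, comp_pt x u = comp_pt x u' -> H u x = H u' x.

Variable y : pt r n.

(** Equal values of [y] form a single token, so the place depends on the value alone. *)
Definition separates (u : {ffun 'I_r -> 'I_k}) : Prop :=
  forall s s', y s = y s' -> u s = u s'.

Definition move_token (u : {ffun 'I_r -> 'I_k}) s (e : 'I_k) :
  {ffun 'I_r -> 'I_k} := [ffun s' => if y s' == y s then e else u s'].

Lemma move_tokenP (u : {ffun 'I_r -> 'I_k}) x s e :
  separates u -> misses u e -> comp_pt x u = y ->
  [/\ separates (move_token u s e), misses (move_token u s e) (u s),
      comp_pt (set_pt x e (y s)) (move_token u s e) = y
    & H u x = H (move_token u s e) (set_pt x e (y s))].
Proof.
move=> Hu He Hx.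
have Ey s' : x (u s') = y s' by rewrite -Hx ffunE.
have Hc : comp_pt (set_pt x e (y s)) (move_token u s e) = y.
  apply/ffunP => s'; rewrite !ffunE; case: (y s' =P y s) => [->|_].
    by rewrite eqxx.
  by rewrite (negPf (forallP He s')) Ey.
split=> //.
- by move=> s1 s2 E; rewrite !ffunE E (Hu s1 s2 E).
- apply/forallP => s'; rewrite ffunE; case: (y s' =P y s) => [_|ne].
    by rewrite eq_sym; apply: (forallP He).
  by apply/eqP => E; apply: ne; rewrite -!Ey E.
- rewrite -(H_unused He x (y s)); apply: H_tie.
  by rewrite Hc comp_set_pt.
Qed.

(** Induction on the number of displaced indices. If the target [w s] of a displaced token is free,
    the token moves there. Otherwise the occupant of [w s], itself displaced, first moves to the
    free place [e], which does not increase the number. *)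
Lemma tokens_separated (w : {ffun 'I_r -> 'I_k}) z :
  separates w -> comp_pt z w = y ->
  forall u x e, separates u -> misses u e -> comp_pt x u = y -> H u x = H w z.
Proof.
move=> Hw Hz u x.
have Ew s s' : w s = w s' -> y s = y s' by rewrite -Hz !ffunE => ->.
have [m] := ubnP #|[set s | u s != w s]|; elim: m u x => // m IH.
have step (u : {ffun 'I_r -> 'I_k}) x e s : (#|[set s | u s != w s]| < m.+1)%N -> separates u ->
    misses u e -> comp_pt x u = y -> u s != w s -> misses u (w s) ->
    H u x = H w z.
  move=> Hm Hu He Hx Hs Hws.
  have [Hu' He' Hx' ->] := move_tokenP s Hu Hws Hx.
  apply: IH Hu' He' Hx'; rewrite -ltnS; apply: leq_trans Hm; rewrite ltnS.
  apply: proper_card; apply/properP; split; last first.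
    by exists s; rewrite !inE // ffunE !eqxx.
  apply/subsetP => s'; rewrite !inE ffunE; case: (y s' =P y s) => // E.
  by rewrite (Hw _ _ E) eqxx.
move=> u x Hm e Hu He Hx.
have Eu s s' : u s = u s' -> y s = y s' by rewrite -Hx !ffunE => ->.
have [/eqP|[s]] := set_0Vmem [set s | u s != w s].
  rewrite -subset0 => /subsetP H0.
  have E : u = w.
    apply/ffunP => s; apply/eqP; apply: contraT => Hs.
    by have := H0 s; rewrite !inE => /(_ Hs).
  rewrite E; apply: (@const_off _ _ _ (H w) (misses w)).
    by move=> i Hi x' a; apply: H_unused.
  move=> i /forallPn[s]; rewrite negbK => /eqP <-.
  by have := congr1 (fun g : pt r n => g s) Hx; rewrite -Hz E !ffunE.
rewrite inE => Hs; have [Hws|] := boolP (misses u (w s)).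
  exact: step Hm Hu He Hx Hs Hws.
move=> /forallPn[s1]; rewrite negbK => /eqP Es1.
have ne1 : y s1 <> y s.
  by move=> E; move: Hs; rewrite -Es1 (Hu _ _ E) eqxx.
have [Hu' He' Hx' ->] := move_tokenP s1 Hu He Hx.
apply: (step _ _ (u s1) s) => //.
- apply: leq_trans Hm; rewrite ltnS; apply: subset_leq_card.
  apply/subsetP => s'; rewrite !inE ffunE; case: (y s' =P y s1) => // E _.
  rewrite (Hu _ _ E) (Hw _ _ E) Es1; apply/eqP => /Ew E'.
  by apply: ne1; rewrite E'.
- by rewrite ffunE; case: (y s =P y s1) => // E; case: ne1; rewrite E.
- by rewrite -Es1.
Qed.

(** All indices with the same value are sent to the place of one representative, as [H_tie]
    permits. *)
Lemma separate (u : {ffun 'I_r -> 'I_k}) x e : misses u e -> comp_pt x u = y ->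
  exists u', [/\ separates u', misses u' e, comp_pt x u' = y & H u x = H u' x].
Proof.
move=> He Hx.
pose u' : {ffun 'I_r -> 'I_k} := [ffun s => u (odflt s [pick s' | y s' == y s])].
have Hc : comp_pt x u' = y.
  apply/ffunP => s; rewrite !ffunE.
  have Ey s' : x (u s') = y s' by rewrite -Hx ffunE.
  by rewrite Ey; case: pickP => [s' /eqP|].
exists u'; split=> //; last by apply: H_tie; rewrite Hc.
- move=> s s' E; rewrite !ffunE.
  have -> : [pick s1 | y s1 == y s] = [pick s1 | y s1 == y s'].
    by apply: eq_pick => s1; rewrite E.
  by case: pickP => // /(_ s'); rewrite eqxx.
- by apply/forallP => s; rewrite ffunE; apply: (forallP He).
Qed.

End Tokens.

Lemma tokens k r n (T : Type) (H : {ffun 'I_r -> 'I_k} -> pt k n -> T) :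
  (forall u e, misses u e -> forall x a, H u (set_pt x e a) = H u x) ->
  (forall u u' x, comp_pt x u = comp_pt x u' -> H u x = H u' x) ->
  forall u w x z e e', misses u e -> misses w e' ->
    comp_pt x u = comp_pt z w -> H u x = H w z.
Proof.
move=> H1 H2 u w x z e e' He He' E.
have [u' [Su Mu Cu ->]] := separate H2 He E.
have [w' [Sw Mw Cw ->]] := separate H2 He' (erefl (comp_pt z w)).
exact: (tokens_separated H1 H2 Sw Cw Su Mu Cu).
Qed.

Definition mono k n (x : pt k n) : bool :=
  [forall i : 'I_k, [forall j : 'I_k, (i <= j)%N ==> (x i <= x j)%N]].

Lemma monoP k n (x : pt k n) :
  reflect (forall i j : 'I_k, (i <= j)%N -> (x i <= x j)%N) (mono x).
Proof.
apply: (iffP forallP) => [H i j ij|H i].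
  by have /forallP/(_ j)/implyP/(_ ij) := H i.
by apply/forallP => j; apply/implyP; apply: H.
Qed.

Lemma sort_perm k (key : 'I_k -> nat) :
  exists s : {perm 'I_k}, forall i j : 'I_k, (i <= j)%N -> (key (s i) <= key (s j))%N.
Proof.
pose e i j := (key i <= key j)%N.
pose q := sort e (enum 'I_k).
have size_q : size q = k by rewrite size_sort size_enum_ord.
have uq : uniq q by rewrite sort_uniq enum_uniq.
have inj : injective (fun i : 'I_k => nth i q i).
  move=> i j /eqP; rewrite (set_nth_default i) ?size_q //.
  by rewrite nth_uniq ?size_q // => /eqP/val_inj.
exists (perm inj) => i j ij; rewrite !permE.
rewrite (set_nth_default i j) ?size_q //.
have tr : transitive e by move=> a b c; apply: leq_trans.
have so : sorted e q by apply: sort_sorted => a b; apply: leq_total.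
by apply: (sorted_leq_nth tr) => //; rewrite ?inE ?size_q // => a; apply: leqnn.
Qed.

(** Both points list the same multiset of values in increasing order. *)
Lemma mono_uniq k n (x : pt k n) (u : {ffun 'I_k -> 'I_k}) :
  injective u -> mono x -> mono (comp_pt x u) -> comp_pt x u = x.
Proof.
move=> inj Hx Hu; pose t (z : pt k n) := [tuple (z i : nat) | i < k].
have so (z : pt k n) : mono z -> sorted leq (t z).
  move=> /monoP Hz; apply/(sortedP 0) => i; rewrite size_tuple => Hi.
  have nthE j (Hj : (j < k)%N) : nth 0 (t z) j = z (Ordinal Hj).
    by have := tnth_nth 0 (t z) (Ordinal Hj); rewrite tnth_mktuple.
  by rewrite !nthE ?(ltnW Hi) // => ?; apply: Hz.
have pe : perm_eq (t (comp_pt x u)) (t x).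
  apply/tuple_permP; exists (perm inj); congr val.
  by apply: eq_from_tnth => i; rewrite !tnth_mktuple permE ffunE.
have /val_inj E := sorted_eq leq_trans anti_leq (so _ Hu) (so _ Hx) pe.
apply/ffunP => i; apply/val_inj.
by have := congr1 (fun s => tnth s i) E; rewrite !tnth_mktuple.
Qed.

(** * Tilings of the cube *)

Definition space d n (x : pt d.+1 n) : pt d n := [ffun i => x (lift ord_max i)].

Definition with_time d n (a : pt d n) (t : 'I_n.+1) : pt d.+1 n :=
  [ffun i => if unlift ord_max i is Some j then a j else t].

Lemma with_time_lift d n (a : pt d n) t i :
  with_time a t (lift ord_max i) = a i.
Proof. by rewrite ffunE liftK. Qed.

Lemma with_time_max d n (a : pt d n) t : with_time a t ord_max = t.
Proof. by rewrite ffunE unlift_none. Qed.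

Lemma space_with_time d n (a : pt d n) t : space (with_time a t) = a.
Proof. by apply/ffunP => i; rewrite ffunE with_time_lift. Qed.

Lemma with_time_space d n (x : pt d.+1 n) : with_time (space x) (x ord_max) = x.
Proof.
apply/ffunP => i; case: (unliftP ord_max i) => [j ->|->].
  by rewrite with_time_lift ffunE.
by rewrite with_time_max.
Qed.

Lemma next_with_time d n (a : pt d n) t i :
  next_pt (with_time a t) (lift ord_max i) = with_time (next_pt a i) t.
Proof.
apply/ffunP => j; rewrite /next_pt set_ptE with_time_lift.
case: (unliftP ord_max j) => [j' ->|->].
  by rewrite !with_time_lift set_ptE (inj_eq lift_inj).
by rewrite !with_time_max (negPf (neq_lift _ _)).
Qed.

Lemma next_time d n (a : pt d n) t :
  next_pt (with_time a t) ord_max = with_time a (ordS t).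
Proof.
apply/ffunP => j; rewrite /next_pt set_ptE with_time_max.
case: (unliftP ord_max j) => [j' ->|->].
  by rewrite !with_time_lift eq_sym (negPf (neq_lift _ _)).
by rewrite !with_time_max eqxx.
Qed.

Definition min_flags k n (x : pt k n) : {ffun 'I_k -> bool} :=
  [ffun j => x j == ord0].

Definition max_flags k n (x : pt k n) : {ffun 'I_k -> bool} :=
  [ffun j => x j == ord_max].

Definition cube_tiling (d : nat) : lang_class d := fun S L =>
  exists (G : finType) (pi : G -> S) (E : 'I_d.+1 -> G -> G -> bool)
    (U : G -> {ffun 'I_d.+1 -> bool} -> {ffun 'I_d.+1 -> bool} -> bool),
  forall n (p : picture d S n), L n p <-> exists D : pt d.+1 n -> G,
    [/\ forall x, pi (D x) = p (pt_tuple (space x)),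
        forall (x : pt d.+1 n) j, x j != ord_max -> E j (D x) (D (next_pt x j))
      & forall x, U (D x) (min_flags x) (max_flags x)].

Lemma ordS_neq0 n (i : 'I_n.+1) : i != ord_max -> ordS i != ord0.
Proof. by move=> Hi; apply/eqP => E; have := val_ordS Hi; rewrite E. Qed.

Lemma ordS_predK n (i : 'I_n.+1) : i != ord0 ->
  ord_pred i != ord_max /\ ordS (ord_pred i) = i.
Proof.
move=> Hi; split; last exact: ord_predK.
by apply: contra Hi => /eqP E; rewrite -(ord_predK i) E ordS_max.
Qed.

Lemma prev_pt k n (x : pt k n) j : x j != ord0 ->
  exists2 y : pt k n, y j != ord_max & next_pt y j = x.
Proof.
move=> /ordS_predK[Hm Hp]; exists (set_pt x j (ord_pred (x j))).
  by rewrite set_ptE eqxx.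
by rewrite next_set_pt Hp set_pt_id.
Qed.

Section CubeTiling.

Variables (d : nat) (G : finType) (E : 'I_d.+1 -> G -> G -> bool).
Variable U : G -> {ffun 'I_d.+1 -> bool} -> {ffun 'I_d.+1 -> bool} -> bool.

Let flagged : finType :=
  (G * ({ffun 'I_d.+1 -> bool} * {ffun 'I_d.+1 -> bool}))%type.

Definition flag_step (i : 'I_d.+1) (g h : flagged) : bool :=
  [&& ~~ g.2.2 i, ~~ h.2.1 i, E i g.1 h.1 &
      [forall j, (j != i) ==> ((h.2.1 j == g.2.1 j) && (h.2.2 j == g.2.2 j))]].

Definition flag_space (i : 'I_d) (g : flagged) (o : option flagged) : bool :=
  U g.1 g.2.1 g.2.2 &&
  (if o is Some h then flag_step (lift ord_max i) g h
   else g.2.2 (lift ord_max i)).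

Definition flag_ends (g h : flagged) : bool :=
  [forall j, g.2.1 j] && h.2.2 ord_max.

Lemma flag_stepP n (D : pt d.+1 n -> G) (x : pt d.+1 n) i : x i != ord_max ->
  E i (D x) (D (next_pt x i)) ->
  flag_step i (D x, (min_flags x, max_flags x))
    (D (next_pt x i), (min_flags (next_pt x i), max_flags (next_pt x i))).
Proof.
move=> xm HE; rewrite /flag_step /= HE !ffunE eqxx xm ordS_neq0 //=.
by apply/forallP => j; apply/implyP => ji; rewrite !ffunE (negPf ji) !eqxx.
Qed.

(** A flag for [j] is constant along the other directions, and a step along [j] forces the minimum
    flag off at its end and the maximum flag off at its start. Each flag is then pinned where it
    must be true: minima at the origin at the first time, spatial maxima by a missing neighbour, the
    temporal maximum at the last time. *)
Lemma flags_correct n (D : pt d.+1 n -> flagged) :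
  (forall a t i, flag_space i (D (with_time a t))
     (if a i == ord_max then None else Some (D (with_time (next_pt a i) t)))) ->
  (forall a t, t != ord_max ->
     flag_step ord_max (D (with_time a t)) (D (with_time a (ordS t)))) ->
  flag_ends (D (with_time (pt0 d n) ord0)) (D (with_time (pt0 d n) ord_max)) ->
  (forall (x : pt d.+1 n) i, x i != ord_max ->
     flag_step i (D x) (D (next_pt x i))) /\
  (forall x, (D x).2 = (min_flags x, max_flags x)).
Proof.
move=> Hs Ht He.
have step (x : pt d.+1 n) i : x i != ord_max -> flag_step i (D x) (D (next_pt x i)).
  rewrite -{2 3}(with_time_space x); case: (unliftP ord_max i) => [j ->|->] Hi.
    have := Hs (space x) (x ord_max) j; rewrite ffunE (negPf Hi) => /andP[_].
    by rewrite next_with_time.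
  by rewrite next_time; apply: Ht.
split=> // x.
have const_flag (T : Type) (f : pt d.+1 n -> T) (j : 'I_d.+1) :
    (forall (x : pt d.+1 n) i, i != j -> x i != ord_max -> f x = f (next_pt x i)) ->
    forall x y : pt d.+1 n, x j = y j -> f x = f y.
  move=> Hf x1 y1 E1; apply: (@const_off _ _ _ f (fun i => i != j)).
    by move=> i Hi; apply: const_along => z; apply: Hf.
  by move=> i; rewrite negbK => /eqP->.
have Cmin j := @const_flag bool (fun x => (D x).2.1 j) j.
have Cmax j := @const_flag bool (fun x => (D x).2.2 j) j.
have mE j (y z : pt d.+1 n) : y j = z j -> (D y).2.1 j = (D z).2.1 j.
  apply: Cmin => x' i ij /step /and4P[_ _ _ /forallP/(_ j)/implyP].
  by rewrite eq_sym ij => /(_ isT) /andP[/eqP].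
have ME j (y z : pt d.+1 n) : y j = z j -> (D y).2.2 j = (D z).2.2 j.
  apply: Cmax => x' i ij /step /and4P[_ _ _ /forallP/(_ j)/implyP].
  by rewrite eq_sym ij => /(_ isT) /andP[_ /eqP].
have /andP[/forallP Hm HM] := He.
have -> : (D x).2 = ((D x).2.1, (D x).2.2) by case: ((D x).2).
congr pair; apply/ffunP => j; rewrite ffunE; case: eqP => [xj|/eqP xj].
- rewrite (@mE j x (with_time (pt0 d n) ord0)) ?Hm // xj.
  by rewrite ffunE; case: unlift => // i; rewrite ffunE.
- have [y ym <-] := prev_pt xj.
  by have /and4P[_ /negPf] := step y j ym.
- case: (unliftP ord_max j) xj => [i ->|->] xj.
    have := Hs (space x) (x ord_max) i.
    by rewrite ffunE xj eqxx with_time_space => /andP[].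
  by rewrite (@ME _ x (with_time (pt0 d n) ord_max)) ?HM // xj with_time_max.
- by have /and4P[/negPf] := step x j xj.
Qed.

End CubeTiling.

Lemma cube_tiling_st d : (0 < d)%N ->
  class_sub (@cube_tiling d) (@st_tiling d).
Proof.
move=> d_gt0 S L [G [pi [E [U HL]]]].
exists (G * ({ffun 'I_d.+1 -> bool} * {ffun 'I_d.+1 -> bool}))%type.
exists (fun g => pi g.1), (flag_space E U), (flag_step E ord_max).
exists (@flag_ends d G) => n p; rewrite HL; split.
  move=> [D [Hpi HE HU]].
  exists (fun a t => let x := with_time a t in (D x, (min_flags x, max_flags x))).
  split.
  - by move=> a t /=; rewrite Hpi space_with_time.
  - move=> a t i; rewrite /flag_space /= HU /=; case: eqP => [ai|/eqP ai].
      by rewrite ffunE with_time_lift ai.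
    by rewrite -next_with_time; apply: flag_stepP; rewrite ?HE // with_time_lift.
  - move=> a t tm /=; rewrite -next_time.
    by apply: flag_stepP; rewrite ?HE // with_time_max.
  - apply/andP; split; last by rewrite ffunE with_time_max.
    by apply/forallP => j; rewrite !ffunE; case: unlift => // i; rewrite ffunE.
move=> [C [Hpi Hs Ht He]].
pose D (x : pt d.+1 n) := C (space x) (x ord_max).
have DE a t : D (with_time a t) = C a t.
  by rewrite /D space_with_time with_time_max.
have [|||step flags] := @flags_correct d G E U n D.
- by move=> a t i; have := Hs a t i; rewrite !DE.
- by move=> a t tm; rewrite !DE; apply: Ht.
- by rewrite !DE.
exists (fun x => (D x).1); split.
- by move=> x; apply: Hpi.
- by move=> x j /step /and4P[].
(* [U] is part of the constraint in every spatial direction, so any one direction yields it. *)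
- move=> x; have := Hs (space x) (x ord_max) (Ordinal d_gt0).
  by rewrite -DE with_time_space => /andP[]; rewrite flags.
Qed.

(** * Folding the cube along its diagonals *)

Definition base_type (S : finType) : finType :=
  (S * ((bool * bool) * (bool * bool)))%type.

(** Coordinates [0] and [1] suffice: an atom about other coordinates is the same atom at a point
    with rearranged coordinates, and the condition [f] of [cube_coloring] sees all those points. *)
Definition base d (S : finType) n (p : picture d S n) (x : pt d.+1 n) :
    base_type S :=
  (p (pt_tuple (space x)),
   ((x ord0 == ord0, x ord0 == ord_max),
    ((x ord0 < x (inord 1))%N, x ord0 == x (inord 1)))).

Definition cube_coloring (d : nat) : lang_class d := fun S L =>
  exists (G : finType) (beta : G -> base_type S)
    (E : 'I_d.+1 -> G -> G -> bool)
    (f : {ffun 'I_d.+1 -> bool} -> {ffun 'I_d.+1 -> bool} ->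
         {ffun {ffun 'I_d.+1 -> 'I_d.+1} -> G} -> bool),
  forall n (p : picture d S n), L n p <-> exists C : pt d.+1 n -> G,
    [/\ forall x, beta (C x) = base p x,
        forall (x : pt d.+1 n) j, x j != ord_max -> E j (C x) (C (next_pt x j))
      & forall x, f (min_flags x) (max_flags x) [ffun u => C (comp_pt x u)]].

(** [x j < x i + 1] holds iff [x i < x j] fails. Each unit step back thus exchanges the two
    arguments and lowers their sum, so the values at the border determine the relation. *)
Lemma lt_of_steps k n (L : pt k n -> 'I_k -> 'I_k -> bool) :
  (forall x i, L x i i = false) ->
  (forall (x : pt k n) i j, x i == ord0 -> L x j i = false) ->
  (forall (x : pt k n) i j, j != i -> x i != ord_max ->
     L (next_pt x i) j i = ~~ L x i j) ->
  forall x i j, L x j i = (x j < x i)%N.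
Proof.
move=> Lii L0 LS x i j; have [->|ji] := eqVneq j i; first by rewrite Lii ltnn.
have [m] := ubnP (x i + x j); elim: m x i j ji => // m IH x i j ji Hm.
have [xi|xi] := eqVneq (x i) ord0; first by rewrite L0 ?xi.
have [y ym Ey] := prev_pt xi.
have Exi : x i = (y i).+1 :> nat by rewrite -Ey set_ptE eqxx val_ordS.
have Exj : x j = y j by rewrite -Ey set_ptE (negPf ji).
rewrite -[in LHS]Ey LS // IH 1?eq_sym //; first by rewrite Exi Exj -leqNgt.
by move: Hm; rewrite Exi Exj; lia.
Qed.

Lemma misses_exists k r (u : {ffun 'I_r -> 'I_k}) :
  (#|codom u| < k)%N -> exists e, misses u e.
Proof.
move=> H; have /subsetPn[e _ He] : ~~ ([set: 'I_k] \subset codom u).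
  apply: contraL H => /subset_leq_card.
  by rewrite cardsT card_ord -leqNgt.
by exists e; apply/forallP => s; apply: contra He => /eqP <-; apply: codom_f.
Qed.

Section Fold.

Variables (d : nat) (S G : finType) (beta : G -> base_type S).
Variables (E : 'I_d.+1 -> G -> G -> bool).
Variable (f : {ffun 'I_d.+1 -> bool} -> {ffun 'I_d.+1 -> bool} ->
         {ffun {ffun 'I_d.+1 -> 'I_d.+1} -> G} -> bool).

Let k := d.+1.

(* The colour at x lists the original colours of all points whose coordinates
   are taken among those of x, the values of the picture at such points, and
   the order of the coordinates. *)
Let folded : finType :=
  ({ffun {ffun 'I_k -> 'I_k} -> G} * {ffun {ffun 'I_d -> 'I_k} -> S} *
   {ffun 'I_k * 'I_k -> bool})%type.

Definition iota_map : {ffun 'I_d -> 'I_k} := [ffun j => lift ord_max j].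

Definition tied (r : nat) (g : folded) (u u' : {ffun 'I_r -> 'I_k}) : bool :=
  [forall s, ~~ g.2 (u s, u' s) && ~~ g.2 (u' s, u s)].

Definition comp_map (r : nat) (u : {ffun 'I_k -> 'I_k})
  (v : {ffun 'I_r -> 'I_k}) : {ffun 'I_r -> 'I_k} := [ffun s => u (v s)].

(** If [u] uses [i] at exactly one position [j], a step along [i] moves the selected point by one
    step along [j], where [E j] applies. If it uses [i] at several positions, the point moves
    diagonally and nothing is required. *)
Definition fold_step (i : 'I_k) (g h : folded) : bool :=
  [&& [forall u, misses u i ==> (g.1.1 u == h.1.1 u)],
      [forall u, misses u i ==> (g.1.2 u == h.1.2 u)],
      [forall u : {ffun 'I_k -> 'I_k}, [forall j,
        [forall s, (u s == i) == (s == j)] ==> E j (g.1.1 u) (h.1.1 u)]] &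
      [forall j, (j != i) ==> (h.2 (j, i) == ~~ g.2 (i, j))]].

Definition fold_local (g : folded) (m M : {ffun 'I_k -> bool}) : bool :=
  [&& [forall i, ~~ g.2 (i, i)],
      [forall i, [forall j, m i ==> ~~ g.2 (j, i)]],
      [forall u, [forall u', tied g u u' ==> (g.1.1 u == g.1.1 u')]],
      [forall u, [forall u', tied g u u' ==> (g.1.2 u == g.1.2 u')]] &
      [forall u : {ffun 'I_k -> 'I_k},
        f [ffun s => m (u s)]
          [ffun s => M (u s)] [ffun v => g.1.1 (comp_map u v)] &&
        (beta (g.1.1 u) ==
          (g.1.2 (comp_map u iota_map),
           ((m (u ord0), M (u ord0)),
            (g.2 (u ord0, u (inord 1)),
             ~~ g.2 (u ord0, u (inord 1)) && ~~ g.2 (u (inord 1), u ord0)))))]].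

Lemma comp_mapE n r (x : pt k n) u (v : {ffun 'I_r -> 'I_k}) :
  comp_pt x (comp_map u v) = comp_pt (comp_pt x u) v.
Proof. by rewrite comp_pt_comp. Qed.

Lemma comp_iota n (x : pt k n) : comp_pt x iota_map = space x.
Proof. by apply/ffunP => s; rewrite !ffunE. Qed.

Lemma comp_next_misses n r (x : pt k n) (u : {ffun 'I_r -> 'I_k}) i :
  misses u i -> comp_pt (next_pt x i) u = comp_pt x u.
Proof. exact: comp_set_pt. Qed.

Lemma comp_next_hit n r (x : pt k n) (u : {ffun 'I_r -> 'I_k}) i j :
  (forall s, (u s == i) = (s == j)) ->
  comp_pt (next_pt x i) u = next_pt (comp_pt x u) j.
Proof.
move=> H; have Ej : u j = i by apply/eqP; rewrite H.
apply/ffunP => s; rewrite !ffunE H; case: eqP => // _.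
by rewrite Ej.
Qed.

Lemma not_lt_eq n (a b : 'I_n) : (~~ (a < b)%N && ~~ (b < a)%N) = (a == b).
Proof. by rewrite -!leqNgt -val_eqE eqn_leq andbC. Qed.

Section FoldCorrect.

Variables (n : nat) (p : picture d S n).

Lemma fold_exists (C : pt k n -> G) :
  (forall x, beta (C x) = base p x) ->
  (forall (x : pt k n) j, x j != ord_max -> E j (C x) (C (next_pt x j))) ->
  (forall x, f (min_flags x) (max_flags x) [ffun u => C (comp_pt x u)]) ->
  exists D : pt k n -> folded,
    [/\ forall x, (D x).1.2 iota_map = p (pt_tuple (space x)),
        forall (x : pt k n) j, x j != ord_max -> fold_step j (D x) (D (next_pt x j))
      & forall x, fold_local (D x) (min_flags x) (max_flags x)].
Proof.
move=> Hb HE Hf.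
pose D (x : pt k n) : folded :=
  ([ffun u => C (comp_pt x u)], [ffun u => p (pt_tuple (comp_pt x u))],
   [ffun ij => (x ij.1 < x ij.2)%N]).
have tiedE r x (u u' : {ffun 'I_r -> 'I_k}) :
    tied (D x) u u' -> comp_pt x u = comp_pt x u'.
  move=> /forallP H; apply/ffunP => s; rewrite !ffunE; apply/eqP.
  by have := H s; rewrite !ffunE /= not_lt_eq.
exists D; split.
- by move=> x; rewrite ffunE comp_iota.
- move=> x i xm; apply/and4P; split.
  + apply/forallP => u; apply/implyP => Hu; rewrite !ffunE.
    by rewrite comp_next_misses.
  + apply/forallP => u; apply/implyP => Hu; rewrite !ffunE.
    by rewrite comp_next_misses.
  + apply/forallP => u; apply/forallP => j; apply/implyP => /forallP Hu.
    have Hu' s : (u s == i) = (s == j) := eqP (Hu s).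
    rewrite !ffunE (comp_next_hit _ Hu'); apply: HE; rewrite ffunE.
    by have /eqP -> : u j == i by rewrite Hu'.
  + apply/forallP => j; apply/implyP => ji.
    by rewrite !ffunE /= eqxx (negPf ji) val_ordS // -leqNgt.
- move=> x; apply/and5P; split.
  + by apply/forallP => i; rewrite ffunE /= ltnn.
  + apply/forallP => i; apply/forallP => j; apply/implyP.
    by rewrite !ffunE /= => /eqP ->.
  + apply/forallP => u; apply/forallP => u'; apply/implyP => /tiedE Hu.
    by rewrite !ffunE Hu.
  + apply/forallP => u; apply/forallP => u'; apply/implyP => /tiedE Hu.
    by rewrite !ffunE Hu.
  + apply/forallP => u; apply/andP; split.
      have := Hf (comp_pt x u); congr (is_true (f _ _ _)); apply/ffunP => s.
      * by rewrite !ffunE.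
      * by rewrite !ffunE.
      * by rewrite !ffunE comp_mapE.
    by rewrite !ffunE Hb /base comp_mapE comp_iota not_lt_eq !ffunE.
Qed.

Section Unfold.

Variable D : pt k n -> folded.
Hypothesis D_pic : forall x, (D x).1.2 iota_map = p (pt_tuple (space x)).
Hypothesis D_step : forall (x : pt k n) j, x j != ord_max ->
  fold_step j (D x) (D (next_pt x j)).
Hypothesis D_local : forall x, fold_local (D x) (min_flags x) (max_flags x).

Lemma D_lt x i j : (D x).2 (i, j) = (x i < x j)%N.
Proof.
apply: (@lt_of_steps k n (fun x i j => (D x).2 (i, j))) => {i j x}.
- by move=> x i; have /and5P[/forallP/(_ i)/negPf] := D_local x.
- move=> x i j xi; have /and5P[_ /forallP/(_ i)/forallP/(_ j)/implyP H _ _ _] := D_local x.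
  by apply: negbTE; apply: H; rewrite ffunE.
- move=> x i j ji xm.
  by have /and4P[_ _ _ /forallP/(_ j)/implyP/(_ ji)/eqP] := D_step xm.
Qed.

Lemma D_tied r x (u u' : {ffun 'I_r -> 'I_k}) :
  comp_pt x u = comp_pt x u' -> tied (D x) u u'.
Proof.
move=> Eu; apply/forallP => s; rewrite !D_lt not_lt_eq.
by have := congr1 (fun g : pt r n => g s) Eu; rewrite !ffunE => ->.
Qed.

Lemma D_tie x u u' : comp_pt x u = comp_pt x u' -> (D x).1.1 u = (D x).1.1 u'.
Proof.
move=> /D_tied Hu.
by have /and5P[_ _ /forallP/(_ u)/forallP/(_ u')/implyP/(_ Hu)/eqP] := D_local x.
Qed.

Lemma D_tokens u w x z e e' : misses u e -> misses w e' ->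
  comp_pt x u = comp_pt z w -> (D x).1.1 u = (D z).1.1 w.
Proof.
apply: (tokens (H := fun u x => (D x).1.1 u)) => [v i Hv|v v' y]; last exact: D_tie.
apply: const_along => y ym.
by have /and4P[/forallP/(_ v)/implyP/(_ Hv)/eqP] := D_step ym.
Qed.

(** A selection of [d] among [d + 1] coordinates leaves one free, so its values can be carried to
    the spatial coordinates, where [D_pic] identifies the entry. *)
Lemma D_picE x u : (D x).1.2 u = p (pt_tuple (comp_pt x u)).
Proof.
have miss (v : {ffun 'I_d -> 'I_k}) : exists e, misses v e.
  apply: misses_exists; rewrite ltnS; apply: leq_trans (leq_image_card _ _) _.
  by rewrite card_ord.
have [e He] := miss u; have [e' He'] := miss iota_map.
pose z := with_time (comp_pt x u) ord0.
have Ez : comp_pt x u = comp_pt z iota_map by rewrite comp_iota space_with_time.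
have := @tokens k d n S (fun u x => (D x).1.2 u) _ _ u iota_map x z e e' He He' Ez.
rewrite D_pic -comp_iota -Ez; apply.
  move=> v i Hv; apply: const_along => y ym.
  by have /and4P[_ /forallP/(_ v)/implyP/(_ Hv)/eqP] := D_step ym.
move=> v v' y /D_tied Hv.
by have /and5P[_ _ _ /forallP/(_ v)/forallP/(_ v')/implyP/(_ Hv)/eqP] := D_local y.
Qed.

Definition sorting (y : pt k n) : {perm 'I_k} :=
  odflt (1%g) [pick s : {perm 'I_k} | mono (comp_pt y [ffun i => s i])].

Definition sorted_pt (y : pt k n) : pt k n := comp_pt y [ffun i => sorting y i].

Definition unsort (y : pt k n) : {ffun 'I_k -> 'I_k} :=
  [ffun i => (sorting y)^-1%g i].

Definition unfold_color (y : pt k n) : G := (D (sorted_pt y)).1.1 (unsort y).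

Lemma sorted_pt_mono y : mono (sorted_pt y).
Proof.
rewrite /sorted_pt /sorting; case: pickP => //= H.
have [s Hs] := sort_perm (fun i => y i : nat).
have := H s; case/negP; apply/monoP => i j ij; rewrite !ffunE.
exact: Hs.
Qed.

Lemma unsortK y : comp_pt (sorted_pt y) (unsort y) = y.
Proof. by apply/ffunP => i; rewrite !ffunE permKV. Qed.

Lemma unsort_inj y : injective (unsort y).
Proof. by move=> i j; rewrite !ffunE => /perm_inj. Qed.

(** For injective [u], sorting [comp_pt x u] gives back [x], and the two selections are tied.
    Otherwise a value is repeated; both [u] and a modification of [unsort y] then leave a place
    free, and [D_tokens] applies. *)
Lemma unfold_colorE x u : mono x -> unfold_color (comp_pt x u) = (D x).1.1 u.
Proof.
move=> Hx; set y := comp_pt x u; rewrite /unfold_color.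
have [inj|] := boolP (injectiveb u).
  have Ex : sorted_pt y = x.
    have := sorted_pt_mono y; rewrite /sorted_pt comp_pt_comp => Hm.
    apply: mono_uniq Hx Hm => i j; rewrite !ffunE.
    by move=> /(injectiveP _ inj) /perm_inj.
  by rewrite Ex; apply: D_tie; rewrite -[in LHS]Ex unsortK.
move=> ninj; have /injectivePn[s [s' ss' Eu]] := ninj.
(* Redirecting [s] to the place of [s'], which holds the same value, frees the place of [s]. *)
pose w := [ffun t => if t == s then unsort y s' else unsort y t].
have Ew : comp_pt (sorted_pt y) w = y.
  have yE r : sorted_pt y (unsort y r) = y r.
    by rewrite -[in RHS](unsortK y) [RHS]ffunE.
  apply/ffunP => t; rewrite [LHS]ffunE [w t]ffunE.
  by case: (t =P s) => [->|_]; rewrite yE // !ffunE Eu.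
transitivity ((D (sorted_pt y)).1.1 w).
  by apply: D_tie; rewrite unsortK.
have mw : misses w (unsort y s).
  apply/forallP => t; rewrite [w t]ffunE; case: (t =P s) => [_|/eqP ts].
    by rewrite (inj_eq (@unsort_inj y)) eq_sym.
  by rewrite (inj_eq (@unsort_inj y)).
have [e me] : exists e, misses u e.
  apply: misses_exists; rewrite -[X in (_ < X)%N](card_ord k) ltn_neqAle leq_image_card andbT.
  apply: contra ninj => /image_injP H; apply/injectiveP => a b.
  exact: H.
exact: D_tokens mw me Ew.
Qed.

Lemma unfold_correct : exists C : pt k n -> G,
  [/\ forall x, beta (C x) = base p x,
      forall (x : pt k n) j, x j != ord_max -> E j (C x) (C (next_pt x j))
    & forall x, f (min_flags x) (max_flags x) [ffun u => C (comp_pt x u)]].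
Proof.
have beta_f y (z := sorted_pt y) (u := unsort y) :
    f [ffun s => min_flags z (u s)] [ffun s => max_flags z (u s)]
      [ffun v => (D z).1.1 (comp_map u v)] &&
    (beta ((D z).1.1 u) ==
      ((D z).1.2 (comp_map u iota_map),
       ((min_flags z (u ord0), max_flags z (u ord0)),
        ((D z).2 (u ord0, u (inord 1)),
         ~~ (D z).2 (u ord0, u (inord 1)) && ~~ (D z).2 (u (inord 1), u ord0))))).
  by have /and5P[_ _ _ _ /forallP/(_ u)] := D_local z.
have yE y s : sorted_pt y (unsort y s) = y s by rewrite -[in RHS](unsortK y) [RHS]ffunE.
have minE y s : min_flags (sorted_pt y) (unsort y s) = (y s == ord0).
  by rewrite [LHS]ffunE yE.
have maxE y s : max_flags (sorted_pt y) (unsort y s) = (y s == ord_max).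
  by rewrite [LHS]ffunE yE.
exists unfold_color; split.
- move=> y; have /andP[_ /eqP ->] := beta_f y.
  by rewrite D_picE comp_mapE unsortK comp_iota !D_lt not_lt_eq !yE minE maxE.
- move=> y j yj.
  (* The key puts [j] last among equal coordinates, so one permutation sorts the point both before
     and after the step along [j]. *)
  have [s Hs] := sort_perm (fun i => 2 * y i + (i == j)).
  pose fs : {ffun 'I_k -> 'I_k} := [ffun i => s i].
  pose fs' : {ffun 'I_k -> 'I_k} := [ffun i => s^-1%g i].
  have sK (x : pt k n) : comp_pt (comp_pt x fs) fs' = x.
    by apply/ffunP => i; rewrite !ffunE permKV.
  have m1 : mono (comp_pt y fs).
    apply/monoP => a b ab; rewrite !ffunE; have := Hs a b ab.
    by case: (s a == j); case: (s b == j); lia.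
  have m2 : mono (comp_pt (next_pt y j) fs).
    apply/monoP => a b ab; rewrite !ffunE; have := Hs a b ab.
    by do 2!case: eqP => [->|_]; rewrite ?(val_ordS yj); lia.
  have E1 : comp_pt (next_pt y j) fs = next_pt (comp_pt y fs) (fs' j).
    by apply: comp_next_hit => a; rewrite !ffunE (can2_eq (permK s) (permKV s)).
  rewrite -[in X in E _ X _](sK y) unfold_colorE // -[in X in E _ _ X](sK (next_pt y j)).
  rewrite unfold_colorE // E1.
  have zm : comp_pt y fs (fs' j) != ord_max by rewrite !ffunE permKV.
  have /and4P[_ _ /forallP/(_ fs')/forallP/(_ j)/implyP H _] := D_step zm.
  apply: H; apply/forallP => a; rewrite !ffunE.
  by rewrite (inj_eq perm_inj).
- move=> y; have /andP[+ _] := beta_f y.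
  congr (is_true (f _ _ _)); apply/ffunP => a.
  + by rewrite [LHS]ffunE minE ffunE.
  + by rewrite [LHS]ffunE maxE ffunE.
  + rewrite [LHS]ffunE [RHS]ffunE -[in RHS](unsortK y) -comp_mapE.
    by rewrite unfold_colorE // sorted_pt_mono.
Qed.

End Unfold.

End FoldCorrect.

End Fold.

Lemma cube_coloring_tiling d : class_sub (@cube_coloring d) (@cube_tiling d).
Proof.
move=> S L [G [beta [E [f HL]]]].
pose folded : finType :=
  ({ffun {ffun 'I_d.+1 -> 'I_d.+1} -> G} * {ffun {ffun 'I_d -> 'I_d.+1} -> S} *
   {ffun 'I_d.+1 * 'I_d.+1 -> bool})%type.
exists folded, (fun g : folded => g.1.2 (iota_map d)), (fold_step E).
exists (fold_local beta f) => n p.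
rewrite HL; split=> [[C [H1 H2 H3]]|[D [H1 H2 H3]]].
  exact: fold_exists H1 H2 H3.
exact: unfold_correct H1 H2 H3.
Qed.

(** * Removing shifts and cyclicity *)

Section Unshift.

Variables (d M : nat) (S G : finType).
Hypothesis d_gt0 : (0 < d)%N.

Let k := d.+1.
Let A : finType := {ffun 'I_k -> 'I_M.+1}.
Let G1 : finType := (G * base_type S)%type.
Let G2 : finType := {ffun A -> G1}.

(* The colour of x in G3 lists the original colours at the points x + a and,
   for each j, the same list for the point obtained from x by resetting its
   j-th coordinate, which is the cyclic successor when x_j is maximal. *)
Let G3 : finType := (G2 * {ffun 'I_k -> G2})%type.

Definition add_pt n (x : pt k n) (a : A) : pt k n :=
  [ffun i => iter (a i) (@ordS n.+1) (x i)].

Definition zero_shift : A := [ffun=> ord0].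

Definition incr (a : A) (j : 'I_k) : A :=
  [ffun i => if i == j then inord (a i).+1 else a i].

Lemma add_pt0 n (x : pt k n) : add_pt x zero_shift = x.
Proof. by apply/ffunP => i; rewrite !ffunE. Qed.

Lemma add_next_pt n (x : pt k n) (a : A) j : (a j < M)%N ->
  add_pt (next_pt x j) a = add_pt x (incr a j).
Proof.
move=> aj; apply/ffunP => i; rewrite !ffunE; case: eqP => [->|//].
by rewrite inordK ?ltnS // -iterSr.
Qed.

Definition shifted (j : 'I_k) (g h : G2) : bool :=
  [forall a : A, (a j < M)%N ==> (h a == g (incr a j))].

Definition unshift_step (j : 'I_k) (g h : G3) : bool :=
  shifted j g.1 h.1 && (g.2 j == h.2 j).

Definition table := {ffun {ffun 'I_k -> 'I_k} -> G3}.

Definition lookup (F : table) (w : {ffun 'I_k -> sterm k M}) : G1 :=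
  (F [ffun i => (w i).1]).1 [ffun i => (w i).2].

Definition ext_map (w : {ffun 'I_d -> sterm k M}) : {ffun 'I_k -> sterm k M} :=
  [ffun i => if unlift ord_max i is Some j then w j else (ord0, ord0)].

(** Each atom is read at one suitable point: extremality of a term where all coordinates equal it, a
    comparison with the two terms at coordinates [0] and [1], a picture value with an arbitrary last
    coordinate. *)
Definition table_view (F : table) : view_type d k k M S G :=
  ([ffun w => (lookup F w).1], [ffun w => (lookup F (ext_map w)).2.1],
   [ffun w => (lookup F [ffun=> w]).2.2.1],
   [ffun w => (lookup F [ffun i => if i == ord0 then w.1 else w.2]).2.2.2]).

Lemma table_viewE n (p : picture d S n) (c : pt k n -> G) x (F : table) :
  (forall w, lookup F w = (c (act w x), base p (act w x))) ->
  table_view F = view M p c x.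
Proof.
move=> HF; rewrite /table_view /view; congr (_, _, _, _); apply/ffunP => w.
- by rewrite !ffunE HF.
- rewrite !ffunE HF /=; congr (p (pt_tuple _)); apply/ffunP => i.
  by rewrite !ffunE liftK.
- by rewrite !ffunE HF /= !ffunE.
- rewrite !ffunE HF /= !ffunE eqxx.
  suff -> : (inord 1 == ord0 :> 'I_k) = false by [].
  by rewrite -val_eqE /= inordK // ltnS.
Qed.

Variable f : view_type d k k M S G -> bool.

Definition unshift_local (m mx : {ffun 'I_k -> bool}) (F : table) : bool :=
  let g := F [ffun i => i] in
  [&& [forall j, m j ==> (g.2 j == g.1)],
      [forall j, mx j ==> shifted j g.1 (g.2 j)] & f (table_view F)].

Lemma comp_pt_id n (x : pt k n) : comp_pt x [ffun i => i] = x.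
Proof. by apply/ffunP => i; rewrite !ffunE. Qed.

Lemma unshift_correct n (p : picture d S n) :
  (exists c : pt k n -> G, forall x, f (view M p c x)) <->
  exists C : pt k n -> G3,
    [/\ forall x, ((C x).1 zero_shift).2 = base p x,
        forall (x : pt k n) j, x j != ord_max -> unshift_step j (C x) (C (next_pt x j))
      & forall x, unshift_local (min_flags x) (max_flags x) [ffun u => C (comp_pt x u)]].
Proof.
split.
  move=> [c Hc].
  pose C2 x : G2 := [ffun a => (c (add_pt x a), base p (add_pt x a))].
  have C2_next x j : shifted j (C2 x) (C2 (next_pt x j)).
    by apply/forallP => a; apply/implyP => aj; rewrite !ffunE add_next_pt.
  exists (fun x => (C2 x, [ffun j => C2 (set_pt x j ord0)])); split.
  - by move=> x; rewrite ffunE add_pt0.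
  - move=> x j _; apply/andP; split; first exact: C2_next.
    by rewrite !ffunE /next_pt set_pt_set.
  - move=> x; rewrite /unshift_local !ffunE comp_pt_id /=; apply/and3P; split.
    + apply/forallP => j; rewrite !ffunE; apply/implyP => /eqP xj.
      by rewrite -xj set_pt_id.
    + apply/forallP => j; rewrite [max_flags _ _]ffunE; apply/implyP => /eqP xj.
      rewrite [in X in shifted _ _ X]ffunE.
      have -> : set_pt x j ord0 = next_pt x j by rewrite /next_pt xj ordS_max.
      exact: C2_next.
    + rewrite (@table_viewE n p c x) // => w.
      rewrite /lookup !ffunE /=.
      suff -> : add_pt (comp_pt x [ffun i => (w i).1]) [ffun i => (w i).2] = act w x by [].
      by apply/ffunP => i; rewrite !ffunE.
move=> [C [Hb HE HL]].
have HL1 x : [&& [forall j, min_flags x j ==> ((C x).2 j == (C x).1)],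
      [forall j, max_flags x j ==> shifted j (C x).1 ((C x).2 j)] &
      f (table_view [ffun u => C (comp_pt x u)])].
  by have := HL x; rewrite /unshift_local ffunE comp_pt_id.
have WE x j : (C x).2 j = (C (set_pt x j ord0)).1.
  rewrite -(@const_along k n _ (fun x => (C x).2 j) j _ x ord0); last first.
    by move=> y ym; have /andP[_ /eqP] := HE y j ym.
  have /and3P[/forallP/(_ j)/implyP H _ _] := HL1 (set_pt x j ord0).
  by apply/eqP/H; rewrite !ffunE eqxx.
have Hsh x j : shifted j (C x).1 (C (next_pt x j)).1.
  have [xj|xj] := eqVneq (x j) ord_max; last by have /andP[] := HE x j xj.
  have /and3P[_ /forallP/(_ j)/implyP H _] := HL1 x.
  by rewrite /next_pt xj ordS_max -WE; apply: H; rewrite ffunE xj.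
(* One unit of shift at a time passes from the list index to the point, by induction on the total
   shift. *)
have CE x a : (C x).1 a = (C (add_pt x a)).1 zero_shift.
  have [r] := ubnP (\sum_i a i); elim: r x a => // r IH x a Hr.
  have [/forallP a0|] := boolP [forall i, a i == ord0].
    have -> : a = zero_shift by apply/ffunP => i; rewrite ffunE; apply/eqP.
    by rewrite add_pt0.
  move=> /forallPn[j aj].
  have aj_gt0 : (0 < a j)%N by move: aj; rewrite -val_eqE /= lt0n.
  pose a' : A := [ffun i => if i == j then inord (a i).-1 else a i].
  have a'j : (a' j).+1 = a j :> nat.
    by rewrite ffunE eqxx inordK ?prednK //; have := ltn_ord (a j); lia.
  have a'M : (a' j < M)%N by have := ltn_ord (a j); rewrite -a'j ltnS.
  have Ea : a = incr a' j.
    apply/ffunP => i; rewrite ffunE; case: eqP => [->|/eqP ij].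
      by apply/val_inj; rewrite /= a'j inordK.
    by rewrite ffunE (negPf ij).
  have /forallP/(_ a')/implyP/(_ a'M)/eqP H := Hsh x j.
  rewrite Ea -H IH ?add_next_pt //.
  move: Hr; rewrite (bigD1 j) //= [in X in _ -> (X < _)%N](bigD1 j) //= -a'j.
  have -> : \sum_(i < k | i != j) a' i = \sum_(i < k | i != j) a i.
    by apply: eq_bigr => i ij; rewrite ffunE (negPf ij).
  by rewrite addSn ltnS.
exists (fun x => ((C x).1 zero_shift).1) => x.
have /and3P[_ _] := HL1 x; rewrite (@table_viewE n p (fun x => ((C x).1 zero_shift).1) x) //.
move=> w; rewrite /lookup ffunE CE.
have -> : add_pt (comp_pt x [ffun i => (w i).1]) [ffun i => (w i).2] = act w x.
  by apply/ffunP => i; rewrite !ffunE.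
by rewrite -Hb; case: ((C (act w x)).1 zero_shift).
Qed.

End Unshift.

Lemma colorable_cube d : (0 < d)%N ->
  class_sub (@colorable d d.+1 d.+1) (@cube_coloring d).
Proof.
move=> d_gt0 S L [G [M [f HL]]].
pose G2 : finType := {ffun {ffun 'I_d.+1 -> 'I_M.+1} -> G * base_type S}.
exists (G2 * {ffun 'I_d.+1 -> G2})%type.
exists (fun g : G2 * {ffun 'I_d.+1 -> G2} => (g.1 (zero_shift d M)).2).
exists (@unshift_step d M S G), (unshift_local f) => n p.
by rewrite HL; apply: unshift_correct.
Qed.

Lemma colorable_NLIN d : (0 < d)%N ->
  class_sub (@colorable d d.+1 d.+1) (@NLIN_CA d).
Proof.
move=> d_gt0 S L /(colorable_cube d_gt0)/cube_coloring_tiling.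
by move=> /(cube_tiling_st d_gt0)/st_tiling_NLIN.
Qed.

(** * Describing runs of cellular automata *)

(* With N = x + y + 1, this is c N + c' - 1 - (x + b N), the number of steps
   that remain after the x-th step of the b-th block of N steps. *)
Definition remaining (c c' : int) (b x y : nat) : int :=
  ((c - b%:Z - 1) * x%:Z + (c - b%:Z) * y%:Z + (c - b%:Z) + c' - 1)%R.

(** With [g = c - b] the coefficients of [x] and [y] are [g - 1] and [g], never of opposite signs. A
    truncated coordinate with nonzero coefficient contributes enough to outweigh [c'] and fix the
    sign; with coefficient zero truncation changes nothing. *)
Lemma remaining_trunc c c' b x y m : (`|c'| + 2 <= m)%N ->
  ((0 < remaining c c' b (minn x m) (minn y m))%R = (0 < remaining c c' b x y)%R) *
  ((remaining c c' b (minn x m) (minn y m) == 0%R) = (remaining c c' b x y == 0%R)).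
Proof.
rewrite /remaining; move: (c - b%:Z)%R => g Hm.
have sgn (i j : int) : (0 < i /\ 0 < j)%R \/ (i < 0 /\ j < 0)%R \/ i = j ->
    ((0 < i)%R = (0 < j)%R) * ((i == 0%R) = (j == 0%R)).
  by move=> [[Hi Hj]|[[Hi Hj]|->]] //; split; lia.
apply: sgn.
have [xm|xm] := leqP x m; have [ym|ym] := leqP y m.
- by right; right.
- have [g0|g0] : (0 < g)%R \/ (g <= 0)%R by lia.
    by left; nia.
  have [g1|g1] : (g = 0)%R \/ (g <= -1)%R by lia.
    by right; right; rewrite g1; lia.
  by right; left; nia.
- have [g0|g0] : (g <= 0)%R \/ (0 < g)%R by lia.
    by right; left; nia.
  have [g1|g1] : (g = 1)%R \/ (1 < g)%R by lia.
    by right; right; rewrite g1; lia.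
  by left; nia.
- have [g0|g0] : (g <= 0)%R \/ (0 < g)%R by lia.
    by right; left; nia.
  by left; nia.
Qed.

Section RunColoring.

Variables (d : nat) (S : finType) (A : automaton d S) (c c' : int).
Hypothesis fast : forall n, (0 < n)%N -> (n%:Z < lin_time c c' n)%R.

Let K := (`|c| + `|c'|)%N.
Let m := (`|c'| + 2)%N.
Let state := ca_state A.
(** A colour holds the states at one offset in all blocks of [N] steps, and the distances of this
    offset to both ends of the block, cut off at [m]. By [time_le], [K] blocks already cover the
    run. *)
Let G : finType := ({ffun 'I_K.+1 -> state} * ('I_m.+1 * 'I_m.+1))%type.
Let time n := `|lin_time c c' n.+1|%N.

Lemma time_gt0 n : (0 < time n)%N.
Proof. by rewrite /time; have := fast (ltn0Sn n); lia. Qed.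

Lemma time_le n : (time n <= K * n.+1)%N.
Proof.
by rewrite /time /K /lin_time; have := fast (ltn0Sn n); rewrite /lin_time; nia.
Qed.

Lemma remaining_pos n (b t : nat) : (t <= n)%N ->
  (0 < remaining c c' b (minn t m) (minn (n - t) m))%R =
  ((t + b * n.+1).+1 < time n)%N.
Proof.
move=> tn; rewrite (remaining_trunc c b t (n - t) (leqnn _)).1.
rewrite /remaining /time; have := fast (ltn0Sn n); rewrite /lin_time => H.
by apply/idP/idP; nia.
Qed.

Lemma remaining_zero n (b t : nat) : (t <= n)%N ->
  (remaining c c' b (minn t m) (minn (n - t) m) == 0%R) =
  ((t + b * n.+1).+1 == time n)%N.
Proof.
move=> tn; rewrite (remaining_trunc c b t (n - t) (leqnn _)).2.
rewrite /remaining /time; have := fast (ltn0Sn n); rewrite /lin_time => H.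
by apply/eqP/eqP; nia.
Qed.

(** [gt] sits at the cyclic time successor: at the end of block [b] this is offset 0, where the run
    continues in block [b + 1]. Transitions are imposed only while steps remain, so later states are
    free. *)
Definition run_cond (g gt : G) (gs : {ffun 'I_d -> G}) (s : S)
    (mn mx : {ffun 'I_d.+1 -> bool}) : bool :=
  [&& mn ord_max ==> (g.2.1 == ord0) && (g.1 ord0 == ca_in A s),
      (if mx ord_max then g.2.2 == ord0
       else (gt.2.1 == minn g.2.1.+1 m :> nat) &&
            (g.2.2 == minn gt.2.2.+1 m :> nat)),
      [forall b : 'I_K.+1, (0 < remaining c c' b g.2.1 g.2.2)%R ==>
         ((if mx ord_max then gt.1 (inord b.+1) else gt.1 b) \in
           ca_delta (g.1 b) [tuple if mx (lift ord_max i) then None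
                                   else Some ((gs i).1 b) | i < d])] &
      [forall b : 'I_K.+1, (remaining c c' b g.2.1 g.2.2 == 0%R) &&
         [forall i, mn (lift ord_max i)] ==> (g.1 b \in ca_final A)]].

Definition run_pred n (p : picture d S n) (C : pt d.+1 n -> G) (x : pt d.+1 n) :=
  run_cond (C x) (C (next_pt x ord_max))
    [ffun i => C (next_pt x (lift ord_max i))] (p (pt_tuple (space x)))
    (min_flags x) (max_flags x).

Lemma local_run_pred : local_fun 1 run_pred.
Proof.
pose J := ((G * G) * {ffun 'I_d -> G} * S *
  ({ffun 'I_d.+1 -> bool} * {ffun 'I_d.+1 -> bool}))%type.
apply: (local_map (fun j : J => run_cond j.1.1.1.1 j.1.1.1.2 j.1.1.2 j.1.2 j.2.1 j.2.2)
  (X := fun n p C x => (C x, C (next_pt x ord_max),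
    [ffun i => C (next_pt x (lift ord_max i))], p (pt_tuple (space x)),
    (min_flags x, max_flags x)))).
apply: (local_map2 pair); last first.
  apply: (local_map2 pair); apply: local_ffun => i.
    exact: local_is_min.
  exact: local_is_max.
apply: (local_map2 pair); last first.
  have := local_pic d.+1 S G [ffun i => (lift ord_max i, ord0) : sterm d.+1 1].
  apply: local_eq => n p C x; congr (p (pt_tuple _)).
  by apply/ffunP => i; rewrite !ffunE.
apply: (local_map2 pair); last first.
  by apply: local_ffun => i; apply: local_next.
apply: (local_map2 pair); first exact: local_self.
exact: local_next.
Qed.

Lemma space_next_lift n (x : pt d.+1 n) i :
  space (next_pt x (lift ord_max i)) = next_pt (space x) i.
Proof. by rewrite -{1}(with_time_space x) next_with_time space_with_time. Qed.

Lemma space_next_time n (x : pt d.+1 n) : space (next_pt x ord_max) = space x.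
Proof. by rewrite -{1}(with_time_space x) next_time space_with_time. Qed.

Lemma nbE n (q : picture d state n) (x : pt d.+1 n) :
  [tuple bordered q (neighbour (pt_tuple (space x)) i) | i < d] =
  [tuple if max_flags x (lift ord_max i) then None
         else Some (q (pt_tuple (space (next_pt x (lift ord_max i))))) | i < d].
Proof.
apply: eq_from_tnth => i; rewrite !tnth_mktuple bordered_neighbour.
by rewrite space_next_lift !ffunE.
Qed.

Lemma run_accepts n (p : picture d S n) :
  ca_accepts A (time n) p <-> exists C, forall x, run_pred p C x.
Proof.
have t0E : [tuple ord0 | i < d] = pt_tuple (pt0 d n).
  by apply: eq_from_tnth => i; rewrite !tnth_mktuple ffunE.
have tn (x : pt d.+1 n) : (x ord_max <= n)%N by rewrite -ltnS.
split.
  move=> [run [run1 step fin]].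
  pose C (x : pt d.+1 n) : G :=
    ([ffun b : 'I_K.+1 => run (x ord_max + b * n.+1).+1 (pt_tuple (space x))],
     (inord (minn (x ord_max) m), inord (minn (n - x ord_max) m))).
  exists C => x.
  have mE z : (inord (minn z m) : 'I_m.+1) = minn z m :> nat.
    by rewrite inordK // ltnS geq_minr.
  apply/and4P; split.
  - apply/implyP; rewrite ffunE => /eqP x0; rewrite /= x0 ffunE /= mul0n.
    by rewrite run1 ffunE eqxx andbT -val_eqE /= mE min0n.
  - rewrite ffunE; case: eqP => [xm|/eqP xm] /=.
      by rewrite -val_eqE /= mE xm /= subnn min0n.
    rewrite !mE set_ptE eqxx val_ordS //; have := tn x.
    move: xm; rewrite -val_eqE /=; move: (x ord_max : nat) => t tm.
    by lia.
  - apply/forallP => b.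
    rewrite [(C x).2.1 : nat]mE [(C x).2.2 : nat]mE remaining_pos //.
    apply/implyP => Ht.
    have := step (x ord_max + b * n.+1).+1 Ht (pt_tuple (space x)).
    rewrite nbE [(C x).1 b]ffunE.
    have -> : [tuple if max_flags x (lift ord_max i) then None
      else Some (run (x ord_max + b * n.+1).+1
                   (pt_tuple (space (next_pt x (lift ord_max i))))) | i < d] =
      [tuple if max_flags x (lift ord_max i) then None
      else Some (([ffun i0 => C (next_pt x (lift ord_max i0))] i).1 b) | i < d].
      apply: eq_from_tnth => i; rewrite !tnth_mktuple; case: ifP => // _.
      by rewrite !ffunE /= (negPf (neq_lift _ _)).
    suff -> : (if max_flags x ord_max then (C (next_pt x ord_max)).1 (inord b.+1)
        else (C (next_pt x ord_max)).1 b) =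
      run (x ord_max + b * n.+1).+2 (pt_tuple (space x)) by [].
    rewrite !ffunE space_next_time /= !eqxx.
    case: eqP => [xm|/eqP xm]; last by rewrite val_ordS.
    rewrite xm ordS_max /= inordK; last first.
      have := time_le n; move: Ht; rewrite xm /= => H1 H2.
      by rewrite ltnS ltnNge; apply/negP => H3; nia.
    by congr (run _ _); lia.
  - apply/forallP => b; rewrite /= !mE remaining_zero //.
    apply/implyP => /andP[/eqP Ht /forallP H0].
    rewrite ffunE Ht; suff -> : space x = pt0 d n by rewrite -t0E.
    by apply/ffunP => i; have := H0 i; rewrite !ffunE => /eqP.
move=> [C HC].
have sE x : (C x).2.1 = minn (x ord_max) m :> nat.
  rewrite -(set_pt_id x ord_max); move: (x ord_max) => t; rewrite set_ptE eqxx.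
  elim/ord_succ_ind: t => [|t tm IH].
    have /and4P[+ _ _ _] := HC (set_pt x ord_max ord0).
    by rewrite !ffunE !eqxx => /andP[/eqP-> _]; rewrite min0n.
  have /and4P[_ + _ _] := HC (set_pt x ord_max t).
  rewrite ffunE set_ptE eqxx (negPf tm) next_set_pt => /andP[/eqP-> _].
  by rewrite IH val_ordS //; lia.
have eE x : (C x).2.2 = minn (n - x ord_max) m :> nat.
  rewrite -(set_pt_id x ord_max); move: (x ord_max) => t; rewrite set_ptE eqxx.
  have [r] := ubnP (n - t); elim: r t => // r IH t Hr.
  have /and4P[_ + _ _] := HC (set_pt x ord_max t).
  rewrite ffunE set_ptE eqxx; case: eqP => [->|/eqP tm].
    by move=> /eqP ->; rewrite subnn min0n.
  have tl : (t < n)%N by have := ltn_ord t; move: tm; rewrite -val_eqE /= => /eqP; lia.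
  rewrite next_set_pt => /andP[_ /eqP->]; rewrite IH val_ordS //; lia.
pose pos u (a : d.-tuple 'I_n.+1) := with_time (tuple_pt a) (inord (u %% n.+1)).
pose run t : picture d state n :=
  [ffun a => (C (pos t.-1 a)).1 (inord (t.-1 %/ n.+1))].
have runE (b : 'I_K.+1) (x : pt d.+1 n) :
    run (x ord_max + b * n.+1).+1 (pt_tuple (space x)) = (C x).1 b.
  rewrite ffunE /pos /= pt_tupleK addnC modnMDl divnMDl // modn_small // divn_small //.
  by rewrite addn0 !inord_val with_time_space.
have decomp u a : (u < time n)%N ->
    exists (b : 'I_K.+1) (x : pt d.+1 n),
      u = (x ord_max + b * n.+1)%N /\ a = pt_tuple (space x).
  move=> Hu; have Hb : (u %/ n.+1 < K.+1)%N.
    by rewrite ltn_divLR //; have := time_le n; nia.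
  exists (Ordinal Hb), (pos u a); split.
    by rewrite with_time_max inordK ?ltn_mod //= addnC -divn_eq.
  by rewrite space_with_time tuple_ptK.
exists run; split.
- apply/ffunP => a; have [b [x [Hu ->]]] := @decomp 0 a (time_gt0 n).
  have x0 : x ord_max = ord0 by apply/val_inj => /=; lia.
  have b0 : b = ord0 by apply/val_inj => /=; nia.
  have := runE b x; rewrite -Hu => ->; have /and4P[+ _ _ _] := HC x.
  by rewrite !ffunE x0 eqxx b0 => /andP[_ /eqP].
- move=> [|u] // /andP[_ Hu] a; have [b [x [Eu ->]]] := @decomp u a (ltnW Hu).
  have /and4P[_ _ /forallP/(_ b)/implyP + _] := HC x.
  rewrite sE eE remaining_pos // -Eu => /(_ Hu).
  have r1 : run u.+1 (pt_tuple (space x)) = (C x).1 b by rewrite Eu runE.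
  rewrite nbE r1.
  have -> : [tuple if max_flags x (lift ord_max i) then None
      else Some (run u.+1 (pt_tuple (space (next_pt x (lift ord_max i))))) | i < d] =
    [tuple if max_flags x (lift ord_max i) then None
      else Some (([ffun i0 => C (next_pt x (lift ord_max i0))] i).1 b) | i < d].
    apply: eq_from_tnth => i; rewrite !tnth_mktuple; case: ifP => // _.
    rewrite ffunE -runE; congr (Some (run _ _)).
    by rewrite Eu set_ptE (negPf (neq_lift _ _)).
  suff -> : (if max_flags x ord_max then (C (next_pt x ord_max)).1 (inord b.+1)
      else (C (next_pt x ord_max)).1 b) = run u.+2 (pt_tuple (space x)) by [].
  rewrite ffunE; case: eqP => [xm|/eqP xm]; rewrite -runE space_next_time.
    congr (run _ _); rewrite set_ptE eqxx xm ordS_max /= inordK; first by rewrite Eu xm /=; lia.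
    have := time_le n; move: Hu; rewrite Eu xm /= => H1 H2.
    by rewrite ltnS ltnNge; apply/negP => H3; nia.
  by congr (run _ _); rewrite set_ptE eqxx val_ordS // Eu.
- have [|b [x [Hu Ea]]] := @decomp (time n).-1 [tuple ord0 | i < d].
    by rewrite prednK // time_gt0.
  have HT : time n = (x ord_max + b * n.+1).+1 by rewrite -Hu prednK // time_gt0.
  rewrite Ea HT runE; have /and4P[_ _ _ /forallP/(_ b)/implyP] := HC x.
  rewrite sE eE remaining_zero // HT eqxx; apply.
  apply/forallP => i; rewrite !ffunE.
  have := congr1 (fun t => tnth t i) Ea.
  by rewrite /= !tnth_mktuple ffunE => <-.
Qed.

End RunColoring.

Lemma NLIN_colorable d : class_sub (@NLIN_CA d) (@colorable d d.+1 d.+1).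
Proof.
move=> S L [A [c [c' [fast HL]]]].
apply: colorable_local (local_run_pred A c c') _ => n p.
by rewrite HL; apply: run_accepts.
Qed.

(** * Recognizable languages *)

Section RecColoring.

Variables (d : nat) (S G : finType) (pi : G -> S).
Variable (D : 'I_d -> {set option G * option G}).

(** Adjacency is symmetric, so tiles are constrained in both orders. *)
Definition both (j : 'I_d) (o o' : option G) : bool :=
  ((o, o') \in D j) && ((o', o) \in D j).

Definition rec_cond (g : G) (gs : {ffun 'I_d -> G}) (s : S)
    (mn mx : {ffun 'I_d -> bool}) : bool :=
  (pi g == s) &&
  [forall j, [&& both j None None, mn j ==> both j None (Some g) &
     both j (Some g) (if mx j then None else Some (gs j))]].

Definition rec_pred n (p : picture d S n) (c : pt d n -> G) (x : pt d n) : bool :=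
  rec_cond (c x) [ffun j => c (next_pt x j)] (p (pt_tuple x))
    (min_flags x) (max_flags x).

Lemma local_rec_pred : local_fun 1 rec_pred.
Proof.
pose J := (G * {ffun 'I_d -> G} * S *
  ({ffun 'I_d -> bool} * {ffun 'I_d -> bool}))%type.
apply: (local_map (fun j : J => rec_cond j.1.1.1 j.1.1.2 j.1.2 j.2.1 j.2.2)
  (X := fun n p c x => (c x, [ffun j => c (next_pt x j)], p (pt_tuple x),
    (min_flags x, max_flags x)))).
apply: (local_map2 pair); last first.
  apply: (local_map2 pair); apply: local_ffun => i.
    exact: local_is_min.
  exact: local_is_max.
apply: (local_map2 pair); last first.
  apply: local_eq (local_pic d S G (id_map d 1)) => n p c x.
  by rewrite act_id.
apply: (local_map2 pair); first exact: local_self.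
by apply: local_ffun => i; apply: local_next.
Qed.

Definition cell n (x : pt d n) : d.-tuple nat := [tuple (x i).+1 | i < d].

Lemma bordered_cell n (q : picture d G n) (x : pt d n) :
  bordered q (cell x) = Some (q (pt_tuple x)).
Proof.
rewrite /bordered ifT; last by apply/forallP => i; rewrite tnth_mktuple /= ltn_ord.
congr (Some (q _)); apply: eq_from_tnth => i; rewrite !tnth_mktuple.
by apply/val_inj; rewrite /= inordK.
Qed.

Lemma bordered_out n (q : picture d G n) (a : d.-tuple nat) i :
  ~~ (0 < tnth a i <= n.+1)%N -> bordered q a = None.
Proof. by move=> Hi; rewrite /bordered ifF //; apply/negbTE/forallPn; exists i. Qed.

Lemma cell_exists n (a : d.-tuple nat) :
  (forall i, 0 < tnth a i <= n.+1)%N -> exists x : pt d n, a = cell x.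
Proof.
move=> Ha; exists [ffun i => inord (tnth a i).-1].
apply: eq_from_tnth => i; have /andP[a0 an] := Ha i.
by rewrite tnth_mktuple ffunE inordK prednK.
Qed.

Hypothesis d_gt1 : (1 < d)%N.

Lemma tiled_rec n (p : picture d S n) :
  (exists2 q : picture d G n, forall j, tiled j (D j) q & p = relabel pi q) <->
  exists c, forall x, rec_pred p c x.
Proof.
split.
  move=> [q Hq ->]; exists (fun x => q (pt_tuple x)) => x.
  have bothP j a b : in_frame n a -> in_frame n b -> adjacent j a b ->
      both j (bordered q a) (bordered q b).
    move=> Ha Hb ab; rewrite /both !Hq //.
    by case: ab => ab1 ab2; split; [move=> i /ab1 ->|case: ab2; [right|left]].
  have frame_cell : in_frame n (cell x).
    by move=> i; rewrite tnth_mktuple; have := ltn_ord (x i); lia.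
  apply/andP; split; first by rewrite ffunE.
  apply/forallP => j; apply/and3P; split.
  (* Since [d >= 2], the frame has [j]-adjacent points that both lie on the border: the zero point
     and its neighbour along [j], whose coordinate [i] is 0. They force the pair of border symbols
     into [D j]. *)
  - have [i ij] : exists i : 'I_d, i != j.
      pose i0 : 'I_d := Ordinal (ltnW d_gt1); pose i1 : 'I_d := Ordinal d_gt1.
      have [<-|ne] := eqVneq i0 j; last by exists i0.
      by exists i1.
    have E1 : bordered q [tuple (0%N : nat) | _ < d] = None.
      by apply: (bordered_out _ (i := i)); rewrite tnth_mktuple.
    have E2 : bordered q [tuple ((k == j) : nat) | k < d] = None.
      by apply: (bordered_out _ (i := i)); rewrite tnth_mktuple (negPf ij).
    rewrite -{1}E1 -E2; apply: bothP => [k|k|]; rewrite ?tnth_mktuple //.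
      by case: eqP.
    split; first by move=> k kj; rewrite !tnth_mktuple (negPf kj).
    by left; rewrite !tnth_mktuple eqxx.
  - apply/implyP; rewrite ffunE => /eqP xj.
    pose a : d.-tuple nat := [tuple if k == j then 0%N else (x k).+1 | k < d].
    have E1 : bordered q a = None.
      by apply: (bordered_out _ (i := j)); rewrite tnth_mktuple eqxx.
    rewrite -{1}E1 -bordered_cell; apply: bothP => //.
      by move=> k; rewrite tnth_mktuple; case: eqP => // _; have := ltn_ord (x k); lia.
    split; first by move=> k kj; rewrite !tnth_mktuple (negPf kj).
    by left; rewrite !tnth_mktuple eqxx xj.
  - rewrite [max_flags x j]ffunE [[ffun k => _] j]ffunE.
    rewrite -bordered_neighbour -bordered_cell; apply: bothP => //.
      move=> k; rewrite !tnth_mktuple; have := ltn_ord (x k); case: (k == j) => /=; lia.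
    split; first by move=> k kj; rewrite !tnth_mktuple (negPf kj) addn0.
    by left; rewrite !tnth_mktuple eqxx addn1.
move=> [c Hc]; exists [ffun a => c (tuple_pt a)]; last first.
  apply/ffunP => a; rewrite !ffunE.
  by have /andP[/eqP-> _] := Hc (tuple_pt a); rewrite tuple_ptK.
set q := finfun _ : picture d G n.
have qE x : q (pt_tuple x) = c x by rewrite ffunE pt_tupleK.
have HD (x : pt d n) j : [&& both j None None, (x j == ord0) ==> both j None (Some (c x)) &
     both j (Some (c x)) (if x j == ord_max then None else Some (c (next_pt x j)))].
  have /andP[_ /forallP/(_ j)] := Hc x.
  by rewrite !ffunE.
have sym j o o' : both j o o' = both j o' o by rewrite /both andbC.
have main j (a b : d.-tuple nat) : (forall i, i != j -> tnth a i = tnth b i) ->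
    tnth b j = (tnth a j).+1 -> both j (bordered q a) (bordered q b).
  move=> Hi Hj.
  have [/forallP /cell_exists[x Ea]|] := boolP [forall i, 0 < tnth a i <= n.+1]%N.
    have -> : b = neighbour (pt_tuple x) j.
      apply: eq_from_tnth => i; rewrite !tnth_mktuple; case: (i =P j) => [->|/eqP ij].
        by rewrite Hj Ea tnth_mktuple addn1.
      by rewrite -Hi // Ea tnth_mktuple addn0.
    rewrite Ea bordered_cell bordered_neighbour !qE.
    by have /and3P[] := HD x j.
  move=> /forallPn[i out_a]; rewrite (bordered_out _ out_a).
  have [/forallP in_b|] := boolP [forall i, 0 < tnth b i <= n.+1]%N; last first.
    move=> /forallPn[i' out_b]; rewrite (bordered_out _ out_b).
    by have /and3P[] := HD (pt0 d n) j.
  have [x Eb] := cell_exists in_b; rewrite Eb bordered_cell qE.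
  have /and3P[_ /implyP H _] := HD x j; apply: H.
  have ij : i = j.
    by apply/eqP; apply: contraNT out_a => ij; rewrite Hi.
  move: out_a; rewrite ij; have := in_b j; rewrite Hj -val_eqE /=.
  have := congr1 (fun t => tnth t j) Eb; rewrite /= tnth_mktuple Hj => -[] ->.
  by case: (x j : nat) => //= y; lia.
move=> j a b _ _ [Hi [Hj|Hj]].
  by have /andP[] := main j a b Hi Hj.
by have /andP[] := main j b a (fun i ij => esym (Hi i ij)) Hj.
Qed.

End RecColoring.

Lemma REC_colorable d : (1 < d)%N -> class_sub (@REC d) (@colorable d d d).
Proof.
move=> d_gt1 S L [G [pi [D [_ HL]]]].
apply: colorable_local (local_rec_pred pi D) _ => n p.
by rewrite HL; apply: tiled_rec.
Qed.

(** * Counting tools for the separations *)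

Lemma collision (T T' : finType) (F : T -> T') :
  (#|T'| < #|T|)%N -> exists x y, x != y /\ F x = F y.
Proof.
move=> lt; have /injectivePn[x [y xy E]] : ~~ injectiveb F.
  by apply: contraL lt => /injectiveP /leq_card; rewrite -leqNgt.
by exists x, y.
Qed.

(** From [g <= 2 ^ g] the left side is at most [2 ^ (g * K * h ^ r)], so [h = g * K + 1] is
    enough. *)
Lemma pow_gap (g K r : nat) :
  exists2 h, (0 < h)%N & (g ^ (K * h ^ r) < 2 ^ (h ^ r.+1))%N.
Proof.
exists (g * K).+1 => //.
have gl : (g <= 2 ^ g)%N by rewrite ltnW // ltn_expl.
apply: leq_ltn_trans (_ : _ <= (2 ^ g) ^ (K * (g * K).+1 ^ r))%N _.
  by case: (K * _)%N => // e; rewrite leq_exp2r.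
rewrite -expnM ltn_exp2l // expnS mulnA ltn_mul2r expn_gt0 /=.
exact: ltnSn.
Qed.

(** * Symmetric pictures are not recognizable *)

Definition swap_map d (i j : 'I_d) : {ffun 'I_d -> 'I_d} :=
  [ffun k => tperm i j k].

Definition symmetric_lang d (i j : 'I_d) : language d bool := fun n p =>
  forall x : pt d n, p (pt_tuple x) ==> p (pt_tuple (comp_pt x (swap_map i j))).

Lemma local_pic_comp d k l (S G : finType) (u : {ffun 'I_d -> 'I_k}) :
  local_fun 0 (fun n (p : picture d S n) (c : pt l n -> G) (v : pt k n) =>
    p (pt_tuple (comp_pt v u))).
Proof.
have := local_pic l S G [ffun i => (u i, ord0) : sterm k 0].
apply: local_eq => n p c v; congr (p (pt_tuple _)); apply/ffunP => i.
by rewrite !ffunE.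
Qed.

Lemma symmetric_colorable d (i j : 'I_d) : colorable d d (symmetric_lang i j).
Proof.
have Hid : local_fun 0 (fun n (p : picture d bool n) (c : pt d n -> unit) (v : pt d n) =>
    p (pt_tuple v)).
  apply: local_eq (local_pic d bool unit (id_map d 0)) => n p c v.
  by rewrite act_id.
have Hsw := @local_pic_comp d d d bool unit (swap_map i j).
apply: (colorable_local (local_map2 implb Hid Hsw)) => n p.
split=> [H|[c H]]; last exact: H.
by exists (fun=> tt).
Qed.

Definition insert_pt d n (i : 'I_d) (a : 'I_n.+1) (y : pt d.-1 n) : pt d n :=
  [ffun k => if unlift i k is Some k' then y k' else a].

Lemma insert_ptE d n (i : 'I_d) (x : pt d n) :
  x = insert_pt i (x i) [ffun k => x (lift i k)].
Proof.
apply/ffunP => k; rewrite ffunE; case: (unliftP i k) => [k' ->|->] //.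
by rewrite ffunE.
Qed.

(** In a picture of side [2 * h], [emb] stores an arbitrary set where [x j >= h] and [x i < h]; its
    mirror image has [x i >= h]. If two sets have equal colours on the hyperplane [x i = h], gluing
    the colouring of the first below it to that of the second above yields an accepted picture with
    the first set and the mirror image of the second, so symmetry gives an inclusion. *)
Lemma symmetric_not_REC d (i j : 'I_d) : i != j -> (1 < d)%N ->
  ~ REC (symmetric_lang i j).
Proof.
move=> ij d_gt1 [G [pi [D [_ HL0]]]].
have HL n (p : picture d bool n) :
    symmetric_lang i j p <-> exists c, forall x, rec_pred pi D p c x.
  by rewrite HL0; apply: tiled_rec.
have [h h_gt0 Hh] := pow_gap #|G| (2 ^ d.-1) d.-1.
pose n := (2 * h).-1; have nE : n.+1 = (2 * h)%N by rewrite /n; lia.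
pose Z : finType := {ffun 'I_d -> 'I_h}.
pose emb (z : Z) : pt d n := [ffun k => inord (z k + (k == j) * h)].
have embE z k : emb z k = (z k + (k == j) * h)%N :> nat.
  by rewrite ffunE inordK // nE; have := ltn_ord (z k); case: (k == j); lia.
have emb_inj : injective emb.
  move=> z z' E; apply/ffunP => k; apply/val_inj.
  have := congr1 (fun x : pt d n => x k : nat) E; rewrite /= !embE.
  by move/addIn.
pose sw (x : pt d n) := comp_pt x (swap_map i j).
have swK : involutive sw by move=> x; apply/ffunP => k; rewrite !ffunE tpermK.
pose pic (phi : {ffun Z -> bool}) : picture d bool n :=
  [ffun a => [exists z, phi z && ((tuple_pt a == emb z) || (tuple_pt a == sw (emb z)))]].
have pic_sym phi : symmetric_lang i j (pic phi).
  move=> x; apply/implyP; rewrite !ffunE !pt_tupleK.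
  move=> /existsP[z /andP[pz xz]]; apply/existsP; exists z; rewrite pz /=.
  case/orP: xz => /eqP->; first by rewrite eqxx orbT.
  by rewrite -/(sw _) swK eqxx.
have [cs Hcs] := fin_all_exists (fun phi => (HL n (pic phi)).1 (pic_sym phi)).
pose sig phi : {ffun pt d.-1 n -> G} :=
  [ffun y => cs phi (insert_pt i (inord h) y)].
have sig_sub phi phi' : sig phi = sig phi' -> forall z, phi z -> phi' z.
  move=> Es z pz.
  pose mix (x : pt d n) := if (x i < h)%N then cs phi x else cs phi' x.
  have agree (x : pt d n) : x i = h :> nat -> cs phi x = cs phi' x.
    move=> xh; have := congr1 (fun s : {ffun pt d.-1 n -> G} => s [ffun k => x (lift i k)]) Es.
    rewrite !ffunE.
    suff -> : insert_pt i (inord h) [ffun k => x (lift i k)] = x by [].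
    rewrite [RHS](insert_ptE i); congr insert_pt.
    by apply/val_inj; rewrite /= inordK // nE; lia.
  have mix1 (x : pt d n) : (x i <= h)%N -> mix x = cs phi x.
    by rewrite /mix leq_eqVlt => /orP[/eqP E|->] //; rewrite E ltnn agree.
  have mix2 (x : pt d n) : (h <= x i)%N -> mix x = cs phi' x.
    by rewrite /mix leqNgt => /negPf->.
  pose pm : picture d bool n := [ffun a => pi (mix (tuple_pt a))].
  have pm_sym : symmetric_lang i j pm.
    apply/HL; exists mix => x.
    have next_i k : x k != ord_max ->
        next_pt x k i = (x i + (k == i))%N :> nat.
      move=> xk; rewrite set_ptE eq_sym; case: eqP => [E|_].
        by rewrite E in xk *; rewrite val_ordS // addn1.
      by rewrite addn0.
    apply/andP; split; first by rewrite ffunE pt_tupleK.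
    case: (ltnP (x i) h) => xh.
      rewrite (mix1 x (ltnW xh)); have /andP[_ /forallP H] := Hcs phi x.
      apply/forallP => k; have := H k; rewrite !ffunE.
      case: (x k =P ord_max) => [//|/eqP xk].
      by rewrite mix1 // next_i //; case: (k == i); rewrite ?addn1 ?addn0 // ltnW.
    rewrite (mix2 x xh); have /andP[_ /forallP H] := Hcs phi' x.
    apply/forallP => k; have := H k; rewrite !ffunE.
    case: (x k =P ord_max) => [//|/eqP xk].
    by rewrite mix2 // next_i //; exact: leq_trans (leq_addr _ _).
  have piE phi0 x : pi (cs phi0 x) = pic phi0 (pt_tuple x).
    by have /andP[/eqP-> _] := Hcs phi0 x.
  have := pm_sym (emb z); rewrite !ffunE !pt_tupleK mix1; last first.
    by rewrite embE (negPf ij) addn0 ltnW.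
  rewrite -/(sw _) piE ffunE pt_tupleK => /implyP H.
  have {}H : pi (mix (sw (emb z))).
    by apply: H; apply/existsP; exists z; rewrite pz eqxx.
  have swi z' : sw (emb z') i = (z' j + h)%N :> nat.
    by rewrite [sw _ _]ffunE [swap_map i j i]ffunE tpermL embE eqxx mul1n.
  move: H; rewrite mix2; last by rewrite swi leq_addl.
  rewrite piE ffunE pt_tupleK => /existsP[z' /andP[pz' /orP[]/eqP E]].
    have := congr1 (fun x : pt d n => x i : nat) E.
    rewrite /= swi embE (negPf ij) addn0; have := ltn_ord (z' i); lia.
  by have /emb_inj -> := can_inj swK E.
have [|phi [phi' [ne Es]]] := @collision _ _ sig.
  rewrite !card_ffun !card_ord card_bool nE.
  rewrite expnMn; move: Hh; rewrite prednK //.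
  by lia.
case/eqP: ne; apply/ffunP => z; apply/idP/idP; first exact: sig_sub.
by apply: sig_sub.
Qed.

(** * One more variable *)

Lemma colorable_dummy d k l :
  class_sub (@colorable d k l) (@colorable d k.+1 l).
Proof.
move=> S L [G [M [f HL]]].
pose up (w : sterm k M) : sterm k.+1 M := (lift ord_max w.1, w.2).
have upE n (v : pt k.+1 n) w : seval (space v) w = seval v (up w).
  by rewrite /seval ffunE.
have actE r n (v : pt k.+1 n) (w : {ffun 'I_r -> sterm k M}) :
    act w (space v) = act [ffun i => up (w i)] v.
  by apply/ffunP => i; rewrite !ffunE upE.
have HX : local_fun M (fun n (p : picture d S n) (c : pt l n -> G) (v : pt k.+1 n) =>
    f (view M p c (space v))).
  exists (fun x : view_type d k.+1 l M S G =>
    f ([ffun w : {ffun 'I_l -> sterm k M} => x.1.1.1 [ffun i => up (w i)]],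
       [ffun w : {ffun 'I_d -> sterm k M} => x.1.1.2 [ffun i => up (w i)]],
       [ffun w => x.1.2 (up w)], [ffun w => x.2 (up w.1, up w.2)])) => n p c v.
  congr (f (_, _, _, _)); apply/ffunP => w; rewrite !ffunE ?actE ?upE //.
apply: colorable_local HX _ => n p; rewrite HL; split=> -[c Hc]; exists c => v.
  exact: Hc.
by rewrite -(space_with_time v ord0).
Qed.

(** With variables [x_0, ..., x_(d-1), y], the index [lift ord_max ord_max] is that of [x_(d-1)]:
    this map selects [(x_(d-1), y, ..., y)], and [target_map] selects [(x_0, ..., x_(d-2), y)]. *)
Definition pivot_map e : {ffun 'I_e.+2 -> 'I_e.+3} :=
  [ffun i => if i == ord0 then lift ord_max ord_max else ord_max].

Definition target_map e : {ffun 'I_e.+2 -> 'I_e.+3} :=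
  [ffun i => if i == ord_max then ord_max else lift ord_max i].

(* For pictures of dimension two this is transitivity: the point (z, y, ..., y)
   allows one to replace a last coordinate z by y. *)
Definition transitive_lang e : language e.+2 bool := fun n p =>
  forall v : pt e.+3 n,
    p (pt_tuple (space v)) && p (pt_tuple (comp_pt v (pivot_map e))) ==>
    p (pt_tuple (comp_pt v (target_map e))).

Lemma transitive_colorable e : colorable e.+3 e.+2 (@transitive_lang e).
Proof.
have H u := @local_pic_comp e.+2 e.+3 e.+2 bool unit u.
have Hs : local_fun 0 (fun n (p : picture e.+2 bool n) (c : pt e.+2 n -> unit) (v : pt e.+3 n) =>
    p (pt_tuple (space v))).
  by apply: local_eq (H (iota_map e.+2)) => n p c v; rewrite comp_iota.
apply: (colorable_local (local_map2 implb (local_map2 andb Hs (H (pivot_map e)))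
  (H (target_map e)))) => n p.
split=> [HL|[c HL]]; last exact: HL.
by exists (fun=> tt).
Qed.

Lemma val_iter_ordS n (x : 'I_n.+1) a :
  iter a (@ordS n.+1) x = (x + a) %% n.+1 :> nat.
Proof.
elim: a => [|a IH]; first by rewrite addn0 modn_small.
by rewrite iterS /= IH -addn1 modnDml addn1 addnS.
Qed.

(** If the shift reaching [H] is the larger one, the other value lies just below [H]. Otherwise the
    way from above [H] to below it wraps around, and the value lies just past 0. *)
Lemma near_boundary n M H (x : 'I_n.+1) a a' :
  (a <= M)%N -> (a' <= M)%N ->
  (iter a (@ordS n.+1) x < H)%N -> (H <= iter a' (@ordS n.+1) x)%N ->
  (iter a (@ordS n.+1) x <= M)%N \/ (H.-1 - iter a (@ordS n.+1) x <= M)%N.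
Proof.
move=> aM aM'; have [aa'|aa'] := leqP a a'.
  rewrite -(subnK aa') iterD; move: (iter a _ x) => y yH.
  rewrite val_iter_ordS => Hy; right.
  have := leq_trans Hy (leq_mod _ _); have : (a' - a <= M)%N by lia.
  by move: (a' - a)%N yH => b; lia.
rewrite -(subnK (ltnW aa')) iterD; move: (iter a' _ x) => y.
rewrite val_iter_ordS => yH Hy; left.
have : (a - a' <= M)%N by lia.
move: (a - a')%N yH => b; have := ltn_ord y.
have [yb|yb] := ltnP (y + b) n.+1.
  by rewrite modn_small //; lia.
rewrite -(subnK yb) modnDr => ? _ ?.
by apply: leq_trans (leq_mod _ _) _; lia.
Qed.

(** * Cutting a colouring in [d] variables at the cube of small coordinates *)

Section Cut.

Variables (e : nat) (G : finType) (M : nat).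
Variable f : view_type e.+2 e.+2 e.+2 M bool G -> bool.
Hypothesis Hf : forall n (p : picture e.+2 bool n), transitive_lang p <->
  exists c, forall v, f (view M p c v).

Let d := e.+2.

(* Points with a coordinate determined by another one up to a shift, or lying
   near the boundary of the region where all coordinates are below H. *)
Definition frontier_index n : finType :=
  ('I_d * (('I_e.+1 * 'I_M.+1) + (bool * 'I_M.+1)) * pt e.+1 n)%type.

Definition frontier n (H : nat) (t : frontier_index n) : pt d n :=
  insert_pt t.1.1
    (match t.1.2 with
     | inl (k, b) => iter b (@ordS n.+1) (t.2 k)
     | inr (true, b) => inord b
     | inr (false, b) => inord (H.-1 - b)
     end) t.2.

Lemma frontier_shift n H (x : pt d n) i j b : i != j -> (b <= M)%N ->
  x j = iter b (@ordS n.+1) (x i) -> exists t, x = frontier H t.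
Proof.
move=> ij bM E; case: (unliftP j i) ij => [k Ei|->]; last by rewrite eqxx.
move=> _; exists (j, inl (k, inord b), [ffun k => x (lift j k)]).
rewrite [LHS](insert_ptE j) /frontier /=; congr insert_pt.
by rewrite ffunE -Ei inordK.
Qed.

Lemma frontier_near n H (x : pt d n) i : (x i < H)%N ->
  (x i <= M)%N \/ (H.-1 - x i <= M)%N -> exists t, x = frontier H t.
Proof.
move=> xH [b|b]; [exists (i, inr (true, inord (x i)), [ffun k => x (lift i k)])|
  exists (i, inr (false, inord (H.-1 - x i)), [ffun k => x (lift i k)])];
  rewrite [LHS](insert_ptE i) /frontier /=; congr insert_pt; rewrite inordK //.
  by rewrite inord_val.
by rewrite subKn ?inord_val //; lia.
Qed.

(** A point made of [d] terms may use all [d] variables, among them [v i], one of whose shifts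
    reaches [H], so the corresponding coordinate is near the boundary. Otherwise it uses a variable
    twice, and two coordinates differ by a bounded shift. *)
Lemma act_frontier n H (v : pt d n) (w : {ffun 'I_d -> sterm d M}) i a :
  (a <= M)%N -> (H <= iter a (@ordS n.+1) (v i))%N ->
  (forall k, act w v k < H)%N -> exists t, act w v = frontier H t.
Proof.
move=> aM Ha Hw; have wM k : ((w k).2 <= M)%N by rewrite -ltnS ltn_ord.
have [inj|] := boolP (injectiveb (fun k => (w k).1)).
  have [g _ gK] := injF_bij (injectiveP _ inj).
  have := Hw (g i); rewrite ffunE /seval gK => Hi.
  apply: (@frontier_near n H _ (g i)) => //; rewrite ffunE /seval gK.
  exact: near_boundary aM Hi Ha.
move=> /injectivePn[s [s' ss' Es]].
wlog le : s s' ss' Es / ((w s).2 <= (w s').2)%N.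
  move=> IH; have [|/ltnW] := leqP (w s).2 (w s').2; first exact: IH.
  by apply: IH; rewrite // eq_sym.
apply: (@frontier_shift n H _ s s' ((w s').2 - (w s).2)) => //.
  by apply: leq_trans (leq_subr _ _) (wM s').
by rewrite !ffunE /seval Es -iterD subnK.
Qed.

Lemma eq_view n (p p' : picture d bool n) (c c' : pt d n -> G) (v : pt d n) :
  (forall w : {ffun 'I_d -> sterm d M},
     c (act w v) = c' (act w v) /\
     p (pt_tuple (act w v)) = p' (pt_tuple (act w v))) ->
  view M p c v = view M p' c' v.
Proof.
move=> Hw; congr (_, _, _, _); apply/ffunP => w; rewrite !ffunE.
  by have [] := Hw w.
by have [] := Hw w.
Qed.

(** [emb 1] stores [phi] with last coordinate in [[h, 2h)], [emb 2] stores [psi] with last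
    coordinate in [[2h, 3h)], and the pivots [mt a] carry the last coordinate [a + h] to [a + 2h].
    Transitivity thus forces [phi] to be included in [psi], across the boundary of [A]. *)
Lemma transitive_cut : False.
Proof.
(* [K] counts the choices of a frontier point apart from its [d - 1] free coordinates. The factor 3
   below comes from the side [3 * h], and the factor 2 from the picture bit, which views also
   read. *)
pose K := (d * (e.+1 * M.+1 + 2 * M.+1))%N.
have [h h_gt0 Hh] := pow_gap (#|G| * 2) (K * 3 ^ e.+1) e.+1.
pose n := (3 * h).-1; have nE : n.+1 = (3 * h)%N by rewrite /n; lia.
pose H := (2 * h)%N.
pose Z : finType := {ffun 'I_d -> 'I_h}.
pose emb o (z : Z) : pt d n := [ffun k => inord (z k + (k == ord_max) * (o * h))].
pose mt (a : 'I_h) : pt d n := [ffun k => inord (a + (if k == ord0 then h else H))].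
have embE o z k : (o <= 2)%N -> emb o z k = (z k + (k == ord_max) * (o * h))%N :> nat.
  by move=> ho; rewrite ffunE inordK // nE; have := ltn_ord (z k); case: (k == _); nia.
have mtE a k : mt a k = (a + (if k == ord0 then h else H))%N :> nat.
  by rewrite ffunE inordK // nE /H; have := ltn_ord a; case: (k == _); lia.
have emb_inj o z z' : (o <= 2)%N -> emb o z = emb o z' -> z = z'.
  move=> ho E; apply/ffunP => k; apply/val_inj.
  have := congr1 (fun x : pt d n => x k : nat) E; rewrite /= !embE //.
  by move/addIn.
have ne0 : (ord0 == ord_max :> 'I_d) = false by [].
have emb0 o z : (o <= 2)%N -> emb o z ord0 = z ord0 :> nat.
  by move=> ho; rewrite embE // ne0 addn0.
have embl o z : (o <= 2)%N -> emb o z ord_max = (z ord_max + o * h)%N :> nat.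
  by move=> ho; rewrite embE // eqxx mul1n.
have mt0 a : mt a ord0 = (a + h)%N :> nat by rewrite mtE.
have mtl a : mt a ord_max = (a + H)%N :> nat by rewrite mtE.
pose P (phi psi : {ffun Z -> bool}) (x : pt d n) :=
  [|| [exists z, phi z && (x == emb 1 z)], [exists z, psi z && (x == emb 2 z)] |
      [exists a, x == mt a]].
pose pic phi psi : picture d bool n := [ffun a => P phi psi (tuple_pt a)].
have picE phi psi x : pic phi psi (pt_tuple x) = P phi psi x.
  by rewrite ffunE pt_tupleK.
have pic_trans phi : transitive_lang (pic phi phi).
  move=> v; rewrite !picE; apply/implyP => /andP[H1 H2].
  have spl : space v ord_max = v (lift ord_max ord_max) by rewrite ffunE.
  (* All points of the picture have last coordinate at least [h], while those of [emb] have first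
     coordinate below [h]; so the second premise can only be a pivot. *)
  have x_ge : (h <= v (lift ord_max ord_max))%N.
    rewrite -spl; case/or3P: H1 => /existsP[z]; last by move=> /eqP->; rewrite mtl; lia.
      by move=> /andP[_ /eqP->]; rewrite embl //; lia.
    by move=> /andP[_ /eqP->]; rewrite embl //; lia.
  have piv0 : comp_pt v (pivot_map e) ord0 = v (lift ord_max ord_max).
    by rewrite !ffunE.
  have pivl : comp_pt v (pivot_map e) ord_max = v ord_max by rewrite !ffunE.
  have [a Ea] : exists a, comp_pt v (pivot_map e) = mt a.
    case/or3P: H2 => /existsP[z]; last by move=> /eqP->; exists z.
      move=> /andP[_ /eqP E]; move: x_ge; rewrite -piv0 E emb0 //.
      by have := ltn_ord (z ord0); lia.
    move=> /andP[_ /eqP E]; move: x_ge; rewrite -piv0 E emb0 //.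
    by have := ltn_ord (z ord0); lia.
  have vl : v (lift ord_max ord_max) = (a + h)%N :> nat by rewrite -piv0 Ea mt0.
  have vt : v ord_max = (a + H)%N :> nat by rewrite -pivl Ea mtl.
  have al := ltn_ord a.
  have [z [pz Ez]] : exists z, phi z /\ space v = emb 1 z.
    case/or3P: H1 => /existsP[z].
    - by move=> /andP[pz /eqP->]; exists z.
    - move=> /andP[_ /eqP E]; have := embl 2 z isT.
      by rewrite -E spl vl; lia.
    - by move=> /eqP E; have := mtl z; rewrite -E spl vl /H; lia.
  apply/or3P; apply: Or32; apply/existsP; exists z; rewrite pz /=; apply/eqP.
  have za : z ord_max = a :> nat.
    by have := embl 1%N z isT; rewrite -Ez spl vl; lia.
  apply/ffunP => k; apply/val_inj; rewrite /= embE // ffunE [target_map e k]ffunE.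
  case: (k =P ord_max) => [->|/eqP kl].
    by rewrite vt za /H mul1n.
  rewrite addn0; have := congr1 (fun x : pt d n => x k : nat) Ez.
  by rewrite /= ffunE embE // (negPf kl) addn0.
have pic_sub phi psi : transitive_lang (pic phi psi) -> forall z, phi z -> psi z.
  move=> HL z pz; have zl := ltn_ord (z ord_max).
  have /implyP := HL (with_time (emb 1%N z) (inord (z ord_max + H))).
  rewrite !picE space_with_time => HP.
  have tl : (inord (z ord_max + H) : 'I_n.+1) = (z ord_max + H)%N :> nat.
    by rewrite inordK // nE /H; lia.
  have {}HP := HP _; have {HP}: P phi psi (emb 2 z).
    have <- : comp_pt (with_time (emb 1%N z) (inord (z ord_max + H))) (target_map e) = emb 2 z.
      apply/ffunP => k; apply/val_inj; rewrite /= embE // ffunE [target_map e k]ffunE.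
      case: (k =P ord_max) => [->|/eqP kl].
        by rewrite with_time_max tl mul1n.
      by rewrite with_time_lift embE // (negPf kl).
    apply: HP; apply/andP; split.
      by apply/or3P; apply: Or31; apply/existsP; exists z; rewrite pz eqxx.
    apply/or3P; apply: Or33; apply/existsP; exists (z ord_max); apply/eqP.
    apply/ffunP => k; apply/val_inj; rewrite /= mtE ffunE [pivot_map e k]ffunE.
    case: (k =P ord0) => _; last by rewrite with_time_max tl.
    by rewrite with_time_lift embl // mul1n.
  case/or3P=> /existsP[z'].
  - move=> /andP[_ /eqP E]; have := embl 2 z isT; rewrite E embl //.
    by have := ltn_ord (z' ord_max); lia.
  - by move=> /andP[pz' /eqP /(emb_inj 2)->].
  - move=> /eqP E; have := emb0 2 z isT; rewrite E mt0.
    by have := ltn_ord (z ord0); lia.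
pose A (x : pt d n) := [forall k, (x k < H)%N].
have emb2_out z : ~~ A (emb 2 z).
  by apply/forallPn; exists ord_max; rewrite embl // -leqNgt /H; lia.
have mt_out a : ~~ A (mt a).
  by apply/forallPn; exists ord_max; rewrite mtl -leqNgt; lia.
have emb1_in z : A (emb 1%N z).
  apply/forallP => k; rewrite embE // /H; have := ltn_ord (z k).
  by case: (k == _); lia.
have P_in phi psi psi' x : A x -> P phi psi x = P phi psi' x.
  move=> Ax; rewrite /P; congr (_ || (_ || _)).
  apply: eq_existsb => z; case: eqP => [E|_]; rewrite ?andbF //.
  by move: (emb2_out z); rewrite -E Ax.
have P_out phi phi' psi x : ~~ A x -> P phi psi x = P phi' psi x.
  move=> Ax; rewrite /P; congr (_ || _).
  apply: eq_existsb => z; case: eqP => [E|_]; rewrite ?andbF //.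
  by move: Ax; rewrite E emb1_in.
have [cs Hcs] := fin_all_exists (fun phi => (Hf (pic phi phi)).1 (pic_trans phi)).
pose sig phi : {ffun frontier_index n -> G * bool} :=
  [ffun t => (cs phi (frontier H t), P phi phi (frontier H t))].
have sig_sub phi phi' : sig phi = sig phi' -> forall z, phi z -> phi' z.
  move=> Es; apply: pic_sub; apply/Hf.
  have agree t : cs phi (frontier H t) = cs phi' (frontier H t) /\
      P phi phi (frontier H t) = P phi' phi' (frontier H t).
    have := congr1 (fun s : {ffun frontier_index n -> G * bool} => s t) Es.
    by rewrite !ffunE => -[-> ->].
  exists (fun x => if A x then cs phi x else cs phi' x) => v.
  (* If all terms over [v] stay below [H], the view lies in [A] and matches that of [phi]. Otherwise
     its points in [A] are on the frontier, where the data of [phi] and [phi'] agree, and it matches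
     that of [phi']. *)
  have [/forallP Hv|] := boolP [forall ia : 'I_d * 'I_M.+1, (seval v ia < H)%N].
    rewrite (@eq_view n _ (pic phi phi) _ (cs phi)) // => w.
    have Aw : A (act w v) by apply/forallP => k; rewrite ffunE.
    by rewrite Aw !picE (P_in _ _ phi).
  move=> /forallPn[[i a]]; rewrite -leqNgt => Hia.
  rewrite (@eq_view n _ (pic phi' phi') _ (cs phi')) // => w.
  rewrite !picE; case: ifPn => Aw; last by rewrite (P_out _ phi').
  rewrite (P_in _ _ phi) //.
  by have [|t ->] := @act_frontier n H v w i a _ Hia (forallP Aw); first by rewrite -ltnS.
have [|phi [phi' [ne Es]]] := @collision _ _ sig.
  rewrite !card_ffun !card_prod card_sum !card_prod !card_ffun !card_ord !card_bool nE.
  by rewrite (expnMn 3) mulnA.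
case/eqP: ne; apply/ffunP => z; apply/idP/idP; first exact: sig_sub.
by apply: sig_sub.
Qed.

End Cut.

Lemma transitive_not_colorable e : ~ colorable e.+2 e.+2 (@transitive_lang e).
Proof. by move=> [G [M [f Hf]]]; apply: transitive_cut Hf. Qed.

(** * Assembling the chain of classes *)

Lemma ESO_var_forall d k : (0 < k)%N ->
  class_sub (@ESO_var d k) (@ESO_forall d k k).
Proof.
move=> k_gt0 S L /(ESO_var_colorable k_gt0).
exact: colorable_ESO.
Qed.

Theorem theorem4 (d : nat) (hd : (2 <= d)%N) :
  class_proper (@REC d) (@ESO_var d d) /\
  class_eq (@ESO_var d d) (@ESO_forall d d d) /\
  class_proper (@ESO_forall d d d) (@ESO_forall d d.+1 d) /\
  class_sub (@ESO_forall d d.+1 d) (@ESO_forall d d.+1 d.+1) /\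
  class_eq (@ESO_forall d d.+1 d.+1) (@ESO_var d d.+1) /\
  class_eq (@ESO_var d d.+1) (@NLIN_CA d).
Proof.
case: d hd => [|[|e]] // hd.
have forall_colorable : class_sub (@ESO_forall e.+2 e.+2 e.+2) (@colorable e.+2 e.+2 e.+2).
  by move=> S L /ESO_forall_var; apply: ESO_var_colorable.
split; first split.
- move=> S L /(REC_colorable hd) HL.
  by apply: ESO_forall_var; apply: colorable_ESO HL.
- exists bool, (@symmetric_lang e.+2 ord0 ord_max); split.
    by apply: ESO_forall_var; apply: colorable_ESO (symmetric_colorable _ _).
  exact: symmetric_not_REC.
split; first by split; [exact: ESO_var_forall|exact: ESO_forall_var].
split; first split.
- move=> S L /forall_colorable/colorable_dummy.
  exact: colorable_ESO.
- exists bool, (@transitive_lang e); split.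
    exact: colorable_ESO (transitive_colorable _).
  by move=> /forall_colorable; apply: transitive_not_colorable.
split; first exact: ESO_forall_arity.
split; first by split; [exact: ESO_forall_var|exact: ESO_var_forall].
split.
  move=> S L /(ESO_var_colorable (ltn0Sn _)).
  exact: colorable_NLIN.
move=> S L /NLIN_colorable HL.
by apply: ESO_forall_var; apply: colorable_ESO HL.
Qed.
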